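(* Let $p\ge3$ be an integer. The geometry of $\mathfrak{C}_p$ is described as follows. (1) If $p$ is odd, then there exist strictly decreasing, continuous functions $U,C,L:(\hat\beta_p,\infty)\to\mathbb{R}$ such that: (a) $C(\tilde\beta_p)=0$, $C(\beta)\to-\infty$ as $\beta\to\infty$, and the set of all points $(\beta,h)$ such that $H_{\beta,h,p}$ has more than one global maximizer is $\{(\beta,C(\beta)):\beta>\hat\beta_p\}$; (b) $L(\beta)<C(\beta)<U(\beta)$ for all $\beta>\hat\beta_p$; (c) $\mathfrak{C}_p=\{(\beta,h):\beta>\hat\beta_p,\ h\in(L(\beta),U(\beta))\}$; (d) $U(\beta)>0$ for all $\beta>\hat\beta_p$ and $\lim_{\beta\to\infty}U(\beta)=0$; (e) as $\beta\to\hat\beta_p$ from the right, all three functions $U(\beta),C(\beta),L(\beta)$ converge to $\hat h_p$. (2) If $p$ is even, then $\beta_p'\in(\hat\beta_p,\tilde\beta_p)$, and there exist continuous functions $U,C:(\hat\beta_p,\infty)\to\mathbb{R}$ and a strictly decreasing, continuous function $L:(\hat\beta_p,\beta_p']\to\mathbb{R}$ such that: (a) $C$ is strictly decreasing on $(\hat\beta_p,\tilde\beta_p)$ and vanishes on $[\tilde\beta_p,\infty)$, and the set of all points $(\beta,h)$ such that $H_{\beta,h,p}$ has more than one global maximizer is $\{(\beta,\pm C(\beta)):\beta>\hat\beta_p\}$; (b) $0<L(\beta)<U(\beta)$ for all $\beta\in(\hat\beta_p,\beta_p')$, $L(\beta_p')=0$, and the graphs of $\pm C$ lie in the interior of the region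 bounded by the graphs of $\pm U$ and $\pm L$; (c) $\mathfrak{C}_p=\{(\beta,h):\beta>\beta_p',\ h\in(-U(\beta),U(\beta))\}\cup\{(\beta,\pm h):\beta\in(\hat\beta_p,\beta_p'],\ h\in(L(\beta),U(\beta))\}$; (d) there exists $\beta_0>\beta_p'$ such that $U$ is strictly decreasing on $(\hat\beta_p,\beta_0)$ and strictly increasing above $\beta_0$; further, $\lim_{\beta\to\infty}U(\beta)=\infty$; (e) as $\beta\to\hat\beta_p$ from the right, all three functions $U(\beta),C(\beta),L(\beta)$ converge to $\hat h_p$.
   Context: Parameter space: $\Theta=(0,\infty)\times\mathbb{R}\ni(\beta,h)$. For $p\ge 2$, $H_{\beta,h,p}:[-1,1]\to\mathbb{R}$ is $H_{\beta,h,p}(x)=\beta x^p+hx-I(x)$, where $I(x)=\frac12\{(1+x)\log(1+x)+(1-x)\log(1-x)\}$. $\mathfrak{C}_p$ is the set of all $(\beta,h)\in\Theta$ such that $H_{\beta,h,p}$ has more than one local maximizer. Constants: $$\hat\beta_p=\frac{1}{2(p-1)}\left(\frac{p}{p-2}\right)^{\frac{p-2}{2}},\qquad \hat h_p=\tanh^{-1}\left(\sqrt{\tfrac{p-2}{p}}\right)-\hat\beta_p\,p\left(\tfrac{p-2}{p}\right)^{\frac{p-1}{2}},$$ $$\tilde\beta_p:=\sup\Big\{\beta>0:\sup_{x\in[0,1]}H_{\beta,0,p}(x)=0\Big\},\qquad \beta_p':=\sup\Big\{\beta>0:\sup_{x\in[0,1]}H'_{\beta,0,p}(x)=0\Big\}.$$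 *)

(* Defs.v *)
From mathcomp Require Import all_boot all_order all_algebra.
From mathcomp Require Import all_classical all_reals all_analysis.
From mathcomp Require Import ring lra.
Import Order.TTheory GRing.Theory Num.Theory.
Import numFieldNormedType.Exports.
Set Implicit Arguments.
Unset Strict Implicit.
Unset Printing Implicit Defensive.
Local Open Scope classical_set_scope.
Local Open Scope ring_scope.

Section Defs.
Context {R : realType}.
Implicit Types (b h x y : R) (p : nat).

Definition tanh x : R := (expR x - expR (- x)) / (expR x + expR (- x)).

(* The inverse hyperbolic tangent on ]-1, 1[, see tanhK and artanhK. *)
Definition artanh y : R := ln ((1 + y) / (1 - y)) / 2.

(* Since [ln 0 = 0], this follows the convention 0 log 0 = 0 at x = 1, -1. *)
Definition entropy x : R :=
  ((1 + x) * ln (1 + x) + (1 - x) * ln (1 - x)) / 2.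

(* Only meaningful for x in [-1, 1]; the maximizers below are relative to that
   interval. *)
Definition H b h p x : R := b * x ^+ p + h * x - entropy x.

Definition global_maximizer b h p x : Prop :=
  x \in `[-1, 1] /\ (forall y, y \in `[-1, 1] -> H b h p y <= H b h p x).

Definition local_maximizer b h p x : Prop :=
  x \in `[-1, 1] /\
  (\forall y \near within `[-1, 1] (nbhs x), H b h p y <= H b h p x).

Definition more_than_one (P : R -> Prop) : Prop :=
  exists x y, [/\ x != y, P x & P y].

(* Points (beta, h) of the parameter space are pairs z = (z.1, z.2). *)
Definition Theta : set (R * R) := [set z | 0 < z.1].

Definition multi_local p : set (R * R) :=
  [set z | Theta z /\ more_than_one (local_maximizer z.1 z.2 p)].

Definition multi_global p : set (R * R) :=
  [set z | Theta z /\ more_than_one (global_maximizer z.1 z.2 p)].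

Definition beta_hat p : R :=
  (2 * (p%:R - 1))^-1 * (p%:R / (p%:R - 2)) `^ ((p%:R - 2) / 2).

Definition h_hat p : R :=
  artanh (Num.sqrt ((p%:R - 2) / p%:R))
  - beta_hat p * p%:R * ((p%:R - 2) / p%:R) `^ ((p%:R - 1) / 2).

(* [sup] is 0 on a set that is empty or unbounded above; all the sets whose
   [sup] is taken below are nonempty and bounded above when 2 <= p. *)
Definition beta_tilde p : R :=
  sup [set b | 0 < b /\ sup [set H b 0 p x | x in `[0, 1]] = 0].

(* The derivative of H tends to -oo at the endpoint 1, where it has no real
   value; leaving 1 out does not change the supremum over [0, 1]. *)
Definition beta_prime p : R :=
  sup [set b | 0 < b /\ sup [set derive1 (H b 0 p) x | x in `[0, 1[] = 0].

Definition strictly_decreasing_on (A : interval R) (f : R -> R) : Prop :=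
  {in A &, {homo f : x y /~ x < y}}.

Definition strictly_increasing_on (A : interval R) (f : R -> R) : Prop :=
  {in A &, {homo f : x y / x < y}}.

(* The closed region bounded by the graphs of U, - U over ]b1, +oo[ and of
   L, - L over ]b1, b2]. *)
Definition bounded_region (b1 b2 : R) (L U : R -> R) : set (R * R) :=
  [set z | [/\ b1 < z.1, `|z.2| <= U z.1 & z.1 <= b2 -> L z.1 <= `|z.2| ]].

Lemma tanhK : cancel tanh artanh.
Proof.
move=> x; rewrite /artanh /tanh.
have e0 := expR_gt0 x; have f0 := expR_gt0 (- x).
have -> : (1 + (expR x - expR (- x)) / (expR x + expR (- x))) /
    (1 - (expR x - expR (- x)) / (expR x + expR (- x))) = expR x / expR (- x).
  by field; apply/and3P; split; apply: lt0r_neq0; lra.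
by rewrite -expRB expRK; field.
Qed.

Lemma artanhK y : -1 < y < 1 -> tanh (artanh y) = y.
Proof.
move=> /andP[y1 y2]; rewrite /tanh.
have q0 : 0 < (1 + y) / (1 - y) by rewrite divr_gt0//; lra.
have e0 := expR_gt0 (artanh y).
have ee : expR (artanh y) * expR (artanh y) = (1 + y) / (1 - y).
  by rewrite -expRD /artanh -splitr lnK// posrE.
rewrite expRN; set e := expR _ in e0 ee *.
have -> : (e - e^-1) / (e + e^-1) = (e * e - 1) / (e * e + 1).
  by field; apply/andP; split; apply: lt0r_neq0; nra.
by rewrite ee; field; repeat (apply/andP; split); apply: lt0r_neq0; lra.
Qed.

End Defs.

(* Main.v *)
Require Import Defs.
From mathcomp Require Import all_boot all_order all_algebra.
From mathcomp Require Import all_classical all_reals all_analysis.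
From mathcomp Require Import ring lra.
Import Order.TTheory GRing.Theory Num.Theory.
Import numFieldNormedType.Exports.
Local Open Scope classical_set_scope.
Local Open Scope ring_scope.

(** The derivative of [H b h p] at [x] is [h - crit_field b p x], where
    [crit_field b p x = artanh x - b p x ^ (p - 1)].  So the critical points
    solve [crit_field b p x = h], and the local maximizers are the points where
    the field [crit_field b p] crosses the level [h] upwards; the endpoints are
    excluded because [artanh] is infinite there.

    The slope of the field has the sign of [1 - b p (p - 1) curv p x], and
    [curv p x = x ^ (p - 2) (1 - x ^ 2)] is unimodal on [0, 1] with its maximum
    at [apex = sqrt ((p - 2) / p)].  The constant [beta_hat p] is the value of
    [b] for which this slope vanishes at [apex] ([beta_hat_curv]).  Up to
    [beta_hat p] the field increases on ]-1, 1[ and there is at most one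
    critical point.  Beyond it, the field on [0, 1[ rises to a point [a], falls
    to a point [c], and rises again, with [a < apex < c] ([shape_ex]).  Let
    [upper b] and [lower b] be its values at [a] and at [c].

    For odd [p] the field also rises on ]-1, 0].  Two rising branches reach the
    level [h] exactly when [lower b < h < upper b] ([multi_local_odd]).  For
    even [p] the field is an odd function, with three rising branches, on
    ]-1, -c[, ]-a, a[ and ]c, 1[.  Two of them reach [h] exactly when
    [lower b < |h| < upper b] if [lower b >= 0], and when
    [|h| < max (upper b) (- lower b)] otherwise.  This makes [beta_prime p] the
    zero of [lower], and the minimum of the outer boundary [upper_even] sits
    where [upper b + lower b = 0].  Since [upper b] and [lower b] are the
    maximum of the field over [0, apex] and its minimum over [apex, 1[, they
    are Lipschitz in [b], and they decrease because the field does at every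
    positive point; no derivative of [a] or [c] is involved.

    For the global maximizers let [gap s b h] be the maximum of [H b h p] over
    [apex, 1] minus that over [s, apex], with [s = -1] for odd [p] and [s = 0]
    for even [p] and [h >= 0].  Several global maximizers exist exactly when
    the gap vanishes (for even [p], also when [h = 0] and the gap is positive,
    because of the mirror image).  Points on the right of [apex] profit more
    from an increase of [b] or [h] than points on its left, so the gap
    increases in both parameters, strictly at its zeros ([gap_diff],
    [gap0_lt], [lt_gap0]).  It changes sign between [lower b] and [upper b].
    Its zero [coex s b] in [h] is therefore unique, strictly decreasing and
    continuous in [b].  Finally [beta_tilde p] is the zero of [coex s], because
    0 maximizes [H b 0 p] on [0, 1] as long as the gap at [h = 0] is not
    positive ([H_le0_coex]). *)

(** * Derivatives of [H] and of its critical field *)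

Section Calculus.
#[local] Set Implicit Arguments.
#[local] Unset Strict Implicit.
Context {R : realType}.
Implicit Types (b h x y z : R) (p : nat).

(** Near 0 the bound [ln u <= u] at [u = t ^ (-1/2)] gives
    [|t ln t| <= 2 sqrt t]; for [t <= 0] the function vanishes. *)
Lemma continuous_xlnx : continuous (fun t : R => t * ln t).
Proof.
have bound (t : R) : `|t| < 1 -> `|t * ln t| <= 2 * Num.sqrt `|t|.
  move=> t1; have [t0|t0] := leP t 0.
    by rewrite ln0// mulr0 normr0 mulr_ge0// sqrtr_ge0.
  rewrite (gtr0_norm t0) in t1 *.
  have s0 : 0 < Num.sqrt t by rewrite sqrtr_gt0.
  have tE : t = Num.sqrt t * Num.sqrt t by rewrite -expr2 sqr_sqrtr// ltW.
  have := ln_sublinear (x := (Num.sqrt t)^-1).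
  rewrite invr_gt0 => /(_ s0); rewrite lnV ?posrE// => ls.
  have l0 : ln t < 0 by apply: ln_lt0; rewrite t0 t1.
  have lE : ln t = 2 * ln (Num.sqrt t).
    by rewrite {1}tE lnM ?posrE//; ring.
  rewrite ltr0_norm; last by rewrite pmulr_rlt0.
  rewrite lE {1}tE.
  set s := Num.sqrt t in s0 ls tE *.
  have : s * - ln s <= s * s^-1 by rewrite ler_pM2l// ltW.
  rewrite mulfV ?gt_eqF//; nra.
move=> t; have [t0|t0|->] := ltgtP t 0.
- rewrite /continuous_at ln0 ?mulr0; last exact: ltW.
  apply: cvg_near_cst; near=> u; rewrite ln0 ?mulr0//.
  by near: u; exact: lt_le_nbhsl.
- by apply: cvgM; [exact: cvg_id|exact: continuous_ln].
- rewrite /continuous_at mul0r; apply/cvgr0Pnorm_lt => e e0.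
  have c0 : {for (0 : R), continuous (fun t : R => 2 * Num.sqrt `|t|)}.
    apply: cvgM; first exact: cvg_cst.
    apply: (@continuous_comp _ _ _ (fun t : R => `|t|) (@Num.sqrt R) 0).
      exact: norm_continuous.
    exact: sqrt_continuous.
  have s0 : (fun t : R => 2 * Num.sqrt `|t|) @ (0 : R) --> (0 : R).
    by move: c0; rewrite /prop_for /continuous_at/= normr0 sqrtr0 mulr0.
  have {}s0 := (cvgr0Pnorm_lt _).1 s0 e e0.
  near=> u; apply: le_lt_trans (bound u _) _.
    by near: u; exact: (@nbhs0_lt R R).
  apply: le_lt_trans (ler_norm _) _.
  by near: u; exact: s0.
Unshelve. all: by end_near. Qed.

Lemma continuous_entropy : continuous (@entropy R).
Proof.
move=> x; apply: cvgM; last exact: cvg_cst.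
apply: cvgD.
  apply: (@continuous_comp _ _ _ (fun x => 1 + x) (fun t : R => t * ln t)).
    by apply: cvgD; [exact: cvg_cst|exact: cvg_id].
  exact: continuous_xlnx.
apply: (@continuous_comp _ _ _ (fun x => 1 - x) (fun t : R => t * ln t)).
  by apply: cvgB; [exact: cvg_cst|exact: cvg_id].
exact: continuous_xlnx.
Qed.

Lemma continuous_H b h p : continuous (H b h p).
Proof.
move=> x; apply: cvgB; last exact: continuous_entropy.
apply: cvgD; (apply: cvgM; first exact: cvg_cst); last exact: cvg_id.
exact: exprn_continuous.
Qed.

(** The field that makes [x] a critical point, as in [is_derive_H]. *)
Definition crit_field b p x : R := artanh x - b * p%:R * x ^+ p.-1.

(** Up to the positive factor [1 - x ^ 2], the slope of [crit_field b p] at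
    [x] is [1 - b * p * (p - 1) * curv p x], see [is_derive_crit_field]. *)
Definition curv p x : R := x ^+ p.-2 * (1 - x ^+ 2).

Lemma is_derive_ln_aff (s x : R) : 0 < 1 + s * x ->
  is_derive x 1 (fun y => ln (1 + s * y)) (s / (1 + s * x)).
Proof.
move=> x1.
have d1 : is_derive x 1 (fun y : R => 1 + s * y) s.
  by apply: is_derive_eq; rewrite /GRing.scale/=; ring.
have d2 : is_derive (1 + s * x) 1 (@ln R) (1 + s * x)^-1 by exact: is_derive1_ln.
have d3 := @is_derive1_comp R (@ln R) (fun y => 1 + s * y) x _ _ d2 d1.
by apply: (is_derive_eq d3); rewrite mulrC.
Qed.

Lemma artanhE x : -1 < x < 1 -> artanh x = (ln (1 + x) - ln (1 - x)) / 2.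
Proof. by move=> x1; rewrite /artanh ln_div ?posrE//; lra. Qed.

Lemma is_derive_artanh x : -1 < x < 1 -> is_derive x 1 (@artanh R) (1 - x ^+ 2)^-1.
Proof.
move=> x1.
have d1 := @is_derive_ln_aff 1 x; have d2 := @is_derive_ln_aff (-1) x.
apply: (@near_eq_is_derive _ _ _
  (fun y => (ln (1 + 1 * y) - ln (1 + -1 * y)) / 2)) => //.
  near=> y; rewrite mul1r mulN1r artanhE//.
  by near: y; apply: near_in_itvoo; rewrite in_itv.
have {}d1 := d1 ltac:(lra); have {}d2 := d2 ltac:(lra).
apply: is_derive_eq; rewrite /GRing.scale/=.
by field; repeat (apply/andP; split); apply: lt0r_neq0; nra.
Unshelve. all: by end_near. Qed.

Lemma is_derive_entropy x : -1 < x < 1 -> is_derive x 1 (@entropy R) (artanh x).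
Proof.
move=> x1; rewrite artanhE//.
have d1 := @is_derive_ln_aff 1 x ltac:(lra).
have d2 := @is_derive_ln_aff (-1) x ltac:(lra).
have -> : @entropy R = fun y =>
    ((1 + 1 * y) * ln (1 + 1 * y) + (1 + -1 * y) * ln (1 + -1 * y)) / 2.
  by apply/funext => y; rewrite mul1r mulN1r.
apply: is_derive_eq; rewrite /GRing.scale/= ?(mul1r, mulN1r, mulr1, mulrN1).
by field; repeat (apply/andP; split); apply: lt0r_neq0; nra.
Qed.

Lemma is_derive_exprn n x :
  is_derive x 1 (fun y : R => y ^+ n) (n%:R * x ^+ n.-1).
Proof.
apply: DeriveDef; first exact: exprn_derivable.
by rewrite exp_derive /GRing.scale/= mulr1.
Qed.

Lemma is_derive_H b h p x : -1 < x < 1 ->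
  is_derive x 1 (H b h p) (h - crit_field b p x).
Proof.
move=> x1; have dI := is_derive_entropy x1.
have dX := is_derive_exprn p x.
have dL : is_derive x 1 (fun y : R => b * y ^+ p + h * y)
    (b * (p%:R * x ^+ p.-1) + h).
  by apply: is_derive_eq; rewrite /GRing.scale/=; ring.
apply: (is_derive_eq (is_deriveB dL dI)); rewrite /crit_field; ring.
Qed.

Lemma is_derive_crit_field b p x : (1 < p)%N -> -1 < x < 1 ->
  is_derive x 1 (crit_field b p)
    ((1 - b * p%:R * (p%:R - 1) * curv p x) / (1 - x ^+ 2)).
Proof.
move=> p1 x1; have dI := is_derive_artanh x1.
have dX := is_derive_exprn p.-1 x.
have dL : is_derive x 1 (fun y : R => b * p%:R * y ^+ p.-1)
    (b * p%:R * (p.-1%:R * x ^+ p.-2)).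
  by apply: is_derive_eq; rewrite /GRing.scale/=; ring.
apply: (is_derive_eq (is_deriveB dI dL)); rewrite /curv.
case: p p1 {dX dL} => [//|[//|p]] _ /=; rewrite -[p.+2%:R]natr1 addrK.
by field; apply: lt0r_neq0; nra.
Qed.

Lemma continuous_crit_field b p x : (1 < p)%N -> -1 < x < 1 ->
  {for x, continuous (crit_field b p)}.
Proof.
move=> p1 x1; have := is_derive_crit_field b p1 x1.
by move=> /@ex_derive /derivable1_diffP /differentiable_continuous.
Qed.

(** Monotonicity from an explicit candidate [df] for the derivative, as the
    [is_derive] lemmas above supply it. *)
Lemma derive_lt_incr (f df : R -> R) x y : x < y ->
  (forall z, x <= z <= y -> {for z, continuous f}) ->
  (forall z, x < z < y -> is_derive z 1 f (df z)) ->
  (forall z, x < z < y -> 0 < df z) -> f x < f y.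
Proof.
move=> xy cf dfE df0.
have dfI z : z \in `]x, y[ -> is_derive z 1 f (df z).
  by rewrite in_itv/=; exact: dfE.
have cI : {within `[x, y], continuous f}.
  by apply: continuous_in_subspaceT => z; rewrite inE/= in_itv/=; exact: cf.
have [z] := MVT xy dfI cI.
rewrite in_itv/= => /df0 z0 fE; rewrite -subr_gt0 fE.
by rewrite mulr_gt0// subr_gt0.
Qed.

Lemma derive_lt_decr (f df : R -> R) x y : x < y ->
  (forall z, x <= z <= y -> {for z, continuous f}) ->
  (forall z, x < z < y -> is_derive z 1 f (df z)) ->
  (forall z, x < z < y -> df z < 0) -> f y < f x.
Proof.
move=> xy cf dfE df0; rewrite -ltrN2.
apply: (@derive_lt_incr (- f) (fun z => - df z) x y xy).
- by move=> z /cf cfz; exact: continuousN.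
- by move=> z /dfE dz; apply: is_deriveN.
- by move=> z /df0; rewrite oppr_gt0.
Qed.

Lemma H_incr b h p x y : -1 <= x -> x < y -> y <= 1 ->
  (forall z, x < z < y -> crit_field b p z < h) -> H b h p x < H b h p y.
Proof.
move=> x1 xy y1 K.
apply: (derive_lt_incr (df := fun z => h - crit_field b p z)) => //.
- by move=> z _; exact: continuous_H.
- by move=> z zxy; apply: is_derive_H; lra.
- by move=> z zxy; rewrite subr_gt0 K.
Qed.

Lemma H_decr b h p x y : -1 <= x -> x < y -> y <= 1 ->
  (forall z, x < z < y -> h < crit_field b p z) -> H b h p y < H b h p x.
Proof.
move=> x1 xy y1 K.
apply: (derive_lt_decr (df := fun z => h - crit_field b p z)) => //.
- by move=> z _; exact: continuous_H.
- by move=> z zxy; apply: is_derive_H; lra.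
- by move=> z zxy; rewrite subr_lt0 K.
Qed.

Lemma crit_field_incr b p x y : (1 < p)%N -> -1 < x -> x < y -> y < 1 ->
  (forall z, x < z < y -> b * p%:R * (p%:R - 1) * curv p z < 1) ->
  crit_field b p x < crit_field b p y.
Proof.
move=> p1 x1 xy y1 K.
apply: (derive_lt_incr (df :=
  fun z => (1 - b * p%:R * (p%:R - 1) * curv p z) / (1 - z ^+ 2))) => //.
- by move=> z zxy; apply: continuous_crit_field => //; lra.
- by move=> z zxy; apply: is_derive_crit_field => //; lra.
- by move=> z zxy; rewrite divr_gt0 ?subr_gt0 ?K//; nra.
Qed.

Lemma crit_field_decr b p x y : (1 < p)%N -> -1 < x -> x < y -> y < 1 ->
  (forall z, x < z < y -> 1 < b * p%:R * (p%:R - 1) * curv p z) ->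
  crit_field b p y < crit_field b p x.
Proof.
move=> p1 x1 xy y1 K.
apply: (derive_lt_decr (df :=
  fun z => (1 - b * p%:R * (p%:R - 1) * curv p z) / (1 - z ^+ 2))) => //.
- by move=> z zxy; apply: continuous_crit_field => //; lra.
- by move=> z zxy; apply: is_derive_crit_field => //; lra.
- by move=> z zxy; rewrite pmulr_llt0 ?invr_gt0 ?subr_lt0 ?K//; nra.
Qed.

Lemma artanh0 : artanh 0 = 0 :> R.
Proof. by rewrite /artanh addr0 subr0 divr1 ln1 mul0r. Qed.

Lemma artanhN x : -1 < x < 1 -> artanh (- x) = - artanh x.
Proof. by move=> x1; rewrite !artanhE ?opprK; [field|lra|lra]. Qed.

Lemma tanh_itv x : -1 < tanh x < 1.
Proof.
have e0 := expR_gt0 x; have f0 := expR_gt0 (- x).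
by rewrite /tanh ltr_pdivrMr ?ltr_pdivlMr; lra.
Qed.

Lemma artanh_incr x y : -1 < x -> x < y -> y < 1 -> artanh x < artanh y.
Proof.
move=> x1 xy y1.
have := @crit_field_incr 0 2 x y isT x1 xy y1.
by rewrite /crit_field !mul0r !subr0; apply=> z _; rewrite !mul0r.
Qed.

Lemma artanh_ge0 x : 0 <= x < 1 -> 0 <= artanh x.
Proof.
case/andP; rewrite le_eqVlt => /predU1P[<-|x0] x1; first by rewrite artanh0.
by rewrite -artanh0 ltW// artanh_incr.
Qed.

Lemma pow_abs_le1 x n : -1 <= x <= 1 -> `|x ^+ n| <= 1.
Proof. by move=> x1; rewrite normrX exprn_ile1// ler_norml. Qed.

(** The logarithmic singularity of the entropy at the endpoints beats the
    bounded polynomial term. *)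
Lemma crit_field_near1 b p h :
  exists2 x0, 0 < x0 < 1 & forall x, x0 <= x < 1 -> h < crit_field b p x.
Proof.
pose t := `|h| + `|b * p%:R| + 1.
have t0 : 0 < t.
  by rewrite /t; have := normr_ge0 h; have := normr_ge0 (b * p%:R); lra.
have tE : artanh (tanh t) = t by exact: tanhK.
have [t1 t2] := andP (tanh_itv t).
have th0 : 0 < tanh t.
  rewrite ltNge; apply/negP; rewrite le_eqVlt => /predU1P[tht0|tht0].
    by move: tE; rewrite tht0 artanh0; lra.
  by have := artanh_incr t1 tht0 ltac:(lra); rewrite tE artanh0; lra.
exists (tanh t) => [|x /andP[tx x1]]; first by rewrite th0.
have tax : t <= artanh x.
  move: tx; rewrite le_eqVlt => /predU1P[<-|tx]; first by rewrite tE.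
  by rewrite -{1}tE ltW// artanh_incr.
have : b * p%:R * x ^+ p.-1 <= `|b * p%:R|.
  rewrite (le_trans (ler_norm _))// normrM ler_piMr// pow_abs_le1//; lra.
have := ler_norm h; rewrite /crit_field; rewrite /t in tax; lra.
Qed.

Lemma crit_field_nearN1 b p h :
  exists2 x0, -1 < x0 < 0 & forall x, -1 < x <= x0 -> crit_field b p x < h.
Proof.
have [x0 x01 K] := crit_field_near1 (b * (-1) ^+ p) p (- h).
exists (- x0); first by lra.
move=> x x1; have := K (- x) ltac:(lra).
rewrite /crit_field artanhN; last by lra.
case: p {K} => [|p]; first by rewrite !mulr0 !mul0r; lra.
have e1 : (-1) ^+ p * (-1) ^+ p = 1 :> R by rewrite -exprMn mulrNN mulr1 expr1n.
rewrite /= [(- x) ^+ p]exprNn exprS.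
have -> : b * (-1 * (-1) ^+ p) * p.+1%:R * ((-1) ^+ p * x ^+ p) =
  - (((-1) ^+ p * (-1) ^+ p) * (b * p.+1%:R * x ^+ p)) by ring.
rewrite e1; lra.
Qed.

Lemma crit_field_ivt b p h x y : (1 < p)%N -> -1 < x -> x < y -> y < 1 ->
  (crit_field b p x - h) * (crit_field b p y - h) < 0 ->
  exists2 z, x < z < y & crit_field b p z = h.
Proof.
move=> p1 x1 xy y1 sgn.
have [||z] := @IVT R (crit_field b p) x y h (ltW xy).
- apply: continuous_in_subspaceT => z; rewrite inE/= in_itv/= => zxy.
  by apply: continuous_crit_field => //; lra.
- by rewrite ge_min le_max; apply/andP; split;
    case: (leP (crit_field b p x) h) => ? //=; nra.
rewrite in_itv/= => /andP[xz zy] zE; exists z => //.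
rewrite !lt_neqAle xz zy !andbT; apply/andP; split; apply/eqP => E; subst z.
  by move: sgn; rewrite zE; nra.
by move: sgn; rewrite zE; nra.
Qed.

End Calculus.

(** * Shape of the critical field on the positive half-line *)

Section Shape.
#[local] Set Implicit Arguments.
#[local] Unset Strict Implicit.
Context {R : realType} {p : nat} (p3 : (3 <= p)%N).
Implicit Types (b h x y z : R).

Let p1 : (1 < p)%N. Proof. exact: ltn_trans p3. Qed.

Lemma p_ge3 : 3 <= p%:R :> R. Proof. by rewrite ler_nat. Qed.

(** The point where [curv p] is largest, see [curv_incr] and [curv_decr]. *)
Definition apex : R := Num.sqrt ((p%:R - 2) / p%:R).
Local Notation m := apex.
Local Notation K b := (crit_field b p).

Lemma apex_sqr : m ^+ 2 = (p%:R - 2) / p%:R.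
Proof.
have pR := p_ge3.
by rewrite sqr_sqrtr// divr_ge0//; lra.
Qed.

Lemma apex_itv : 0 < m < 1.
Proof.
have pR := p_ge3.
have p0 : 0 < p%:R :> R by lra.
have m0 : 0 < m by rewrite sqrtr_gt0 divr_gt0//; lra.
rewrite m0/= -(ltr_pXn2r (n := 2))// ?nnegrE//; last exact: ltW.
by rewrite expr1n apex_sqr ltr_pdivrMr//; lra.
Qed.

Lemma is_derive_curv x :
  is_derive x 1 (curv p) (x ^+ p.-2.-1 * (p%:R - 2 - p%:R * x ^+ 2)).
Proof.
have dX := is_derive_exprn p.-2 x; have d2 := is_derive_exprn 2 x.
have d1 : is_derive x 1 (fun y : R => 1 - y ^+ 2) (- (2 * x)).
  by apply: is_derive_eq; rewrite expr1; ring.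
apply: (is_derive_eq (is_deriveM dX d1)); rewrite /GRing.scale/=.
case: p p3 {dX} => [//|[//|[//|n]]] _ /=.
rewrite (_ : n.+3%:R = n.+1%:R + 2 :> R); last by rewrite -natrD addn2.
by rewrite exprS; ring.
Qed.

Lemma continuous_curv : continuous (curv p : R -> R).
Proof.
move=> x; have := is_derive_curv x.
by move=> /@ex_derive /derivable1_diffP /differentiable_continuous.
Qed.

Lemma curv_incr x y : 0 <= x -> x < y -> y <= m -> curv p x < curv p y.
Proof.
have pR := p_ge3; have [m0 m1] := andP apex_itv.
move=> x0 xy ym; apply: (derive_lt_incr xy).
- by move=> z _; exact: continuous_curv.
- by move=> z _; exact: is_derive_curv.
move=> z /andP[xz zy]; rewrite mulr_gt0 ?exprn_gt0//; first by lra.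
rewrite subr_gt0.
have : z ^+ 2 < m ^+ 2 by rewrite ltr_pXn2r// ?nnegrE; lra.
by rewrite apex_sqr ltr_pdivlMr ?[_ * p%:R]mulrC//; lra.
Qed.

Lemma curv_decr x y : m <= x -> x < y -> curv p y < curv p x.
Proof.
have pR := p_ge3; have [m0 m1] := andP apex_itv.
move=> mx xy; apply: (derive_lt_decr xy).
- by move=> z _; exact: continuous_curv.
- by move=> z _; exact: is_derive_curv.
move=> z /andP[xz zy].
rewrite pmulr_rlt0 ?exprn_gt0 ?subr_lt0//; last by lra.
have : m ^+ 2 < z ^+ 2 by rewrite ltr_pXn2r// ?nnegrE; lra.
by rewrite apex_sqr ltr_pdivrMr ?[_ * p%:R]mulrC//; lra.
Qed.

Lemma sqrt_exprn q n : 0 <= q -> Num.sqrt q ^+ n = q `^ (n%:R / 2) :> R.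
Proof.
move=> q0; rewrite -powR12_sqrt// -powR_mulrn ?powR_ge0// -powRrM.
by congr (_ `^ _); rewrite mulrC.
Qed.

Lemma beta_hat_gt0 : 0 < beta_hat p :> R.
Proof.
have pR := p_ge3.
rewrite /beta_hat mulr_gt0 ?invr_gt0 ?powR_gt0 ?divr_gt0//; lra.
Qed.

Lemma beta_hat_curv : beta_hat p * p%:R * (p%:R - 1) * curv p m = 1 :> R.
Proof.
have pR := p_ge3.
have q0 : 0 < (p%:R - 2) / p%:R :> R by rewrite divr_gt0//; lra.
rewrite /beta_hat /curv apex_sqr /m sqrt_exprn ?ltW//.
have -> : p.-2%:R = p%:R - 2 :> R.
  by rewrite -subn2 natrB.
have -> : p%:R / (p%:R - 2) = ((p%:R - 2) / p%:R)^-1 :> R by rewrite invf_div.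
set e := (p%:R - 2) / 2.
have -> : ((p%:R - 2) / p%:R)^-1 `^ e = (((p%:R - 2) / p%:R) `^ e)^-1 :> R.
  by rewrite -powR_inv1 ?ltW// -powRrM mulN1r powRN.
have := powR_gt0 e q0; move: (_ `^ e) => t t0.
by field; repeat (apply/andP; split); apply: lt0r_neq0; lra.
Qed.

Lemma h_hatE : h_hat p = crit_field (beta_hat p) p m.
Proof.
have pR := p_ge3; have [m0 m1] := andP apex_itv.
rewrite /h_hat /crit_field /m sqrt_exprn ?divr_ge0//; last by lra.
suff -> : p.-1%:R = p%:R - 1 :> R by [].
by rewrite -subn1 natrB// ltnW.
Qed.

(** The curvature is below its critical value off [m] as long as
    [b <= beta_hat p]. *)
Lemma crit_field_incr_sub b x y : 0 < b <= beta_hat p ->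
  0 <= x -> x < y -> y < 1 -> K b x < K b y.
Proof.
have pR := p_ge3; have [m0 m1] := andP apex_itv.
move=> /andP[b0 bh] x0 xy y1.
have lt1 z : 0 <= z -> curv p z < curv p m ->
    b * p%:R * (p%:R - 1) * curv p z < 1.
  move=> z0 zm; rewrite -[X in _ < X](@beta_hat_curv).
  have bp : 0 < b * p%:R * (p%:R - 1) by rewrite !mulr_gt0//; lra.
  apply: (lt_le_trans (y := b * p%:R * (p%:R - 1) * curv p m)).
    by rewrite ltr_pM2l.
  move: (beta_hat p) bh => B bB.
  rewrite -!mulrA; apply: ler_wpM2r => //; rewrite !mulr_ge0//; first by lra.
    by rewrite exprn_ge0// ltW.
  by rewrite subr_ge0 exprn_ile1// ltW.
have le_m u v : 0 <= u -> u < v -> v <= m -> K b u < K b v.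
  move=> u0 uv vm; apply: crit_field_incr => //; try lra.
  by move=> z zuv; apply: lt1; [lra|apply: curv_incr; lra].
have ge_m u v : m <= u -> u < v -> v < 1 -> K b u < K b v.
  move=> mu uv v1; apply: crit_field_incr => //; try lra.
  by move=> z zuv; apply: lt1; [lra|apply: curv_decr; lra].
have [ym|ym] := leP y m; first exact: le_m.
have [xm|xm] := leP m x; first exact: ge_m.
by apply: (lt_trans (y := K b m)); [exact: le_m|exact: ge_m].
Qed.

(** The turning points [a] and [c] have no closed form; only their position
    relative to [apex] and the three monotone branches matter. *)
Definition crit_shape b (a c : R) :=
  [/\ 0 < a < m, m < c < 1,
      forall x y, 0 <= x -> x < y -> y <= a -> K b x < K b y,
      forall x y, a <= x -> x < y -> y <= c -> K b y < K b x &
      forall x y, c <= x -> x < y -> y < 1 -> K b x < K b y].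

(** [a] and [c] are the two points where [curv p], unimodal with peak at [m],
    takes the value [1 / (b p (p - 1))]. *)
Lemma shape_ex b : beta_hat p < b -> exists a c, crit_shape b a c.
Proof.
have pR := p_ge3; have [m0 m1] := andP apex_itv.
move=> bb; have b0 : 0 < b := lt_trans beta_hat_gt0 bb.
pose k := b * p%:R * (p%:R - 1).
have k0 : 0 < k by rewrite !mulr_gt0//; lra.
have cm0 : 0 < curv p m.
  by rewrite mulr_gt0 ?exprn_gt0// subr_gt0 exprn_ilt1// ltW.
have km : k^-1 < curv p m.
  rewrite -div1r ltr_pdivrMr// -[X in X < _](@beta_hat_curv).
  move: (beta_hat p) bb => B bb.
  rewrite [ltRHS]mulrC ltr_pM2r// /k -!mulrA ltr_pM2r// mulr_gt0//; lra.
have cont0 x y : {within `[x, y], continuous (curv p : R -> R)}.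
  exact/continuous_subspaceT/continuous_curv.
have k1 : 0 < k^-1 by rewrite invr_gt0.
have curv0 : curv p 0 = 0 :> R.
  by rewrite /curv expr0n; case: p p3 => [|[|[|]]]//= *; rewrite mul0r.
have curv1 : curv p 1 = 0 :> R by rewrite /curv !expr1n subrr mulr0.
have [a] := @IVT R (curv p) 0 m k^-1 (ltW m0) (cont0 _ _)
  ltac:(by rewrite curv0 min_l ?max_r// ltW//= ltW).
rewrite in_itv/= => /andP[a0 am] aE.
have [c] := @IVT R (curv p) m 1 k^-1 (ltW m1) (cont0 _ _)
  ltac:(by rewrite curv1 min_r ?max_l// ltW//= ltW).
rewrite in_itv/= => /andP[mc c1] cE.
have {}a0 : 0 < a.
  by rewrite lt_neqAle a0 andbT; apply/eqP => E; move: aE; rewrite -E curv0; lra.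
have {}am : a < m.
  by rewrite lt_neqAle am andbT; apply/eqP => E; move: aE; rewrite E; lra.
have {}mc : m < c.
  by rewrite lt_neqAle mc andbT; apply/eqP => E; move: cE; rewrite -E; lra.
have {}c1 : c < 1.
  by rewrite lt_neqAle c1 andbT; apply/eqP => E; move: cE; rewrite E curv1; lra.
have kk : k * k^-1 = 1 by rewrite mulfV// gt_eqF.
exists a, c; split; rewrite ?a0 ?mc//.
- move=> x y x0 xy ya; apply: crit_field_incr => //; try lra.
  move=> z zxy; rewrite -/k -[X in _ < X]kk ltr_pM2l// -aE.
  by apply: curv_incr; lra.
- move=> x y ax xy yc; apply: crit_field_decr => //; try lra.
  move=> z zxy; rewrite -/k -[X in X < _]kk ltr_pM2l//.
  have [zm|mz] := leP z m; first by rewrite -aE; apply: curv_incr; lra.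
  by rewrite -cE; apply: curv_decr; lra.
- move=> x y cx xy y1; apply: crit_field_incr => //; try lra.
  move=> z zxy; rewrite -/k -[X in _ < X]kk ltr_pM2l// -cE.
  by apply: curv_decr; lra.
Qed.

Lemma crit_field0 b : K b 0 = 0.
Proof.
rewrite /crit_field artanh0 expr0n.
by case: p p3 => [|[|[|]]]//= *; rewrite mulr0 subr0.
Qed.

Lemma crit_fieldN b x : ~~ odd p -> -1 < x < 1 -> K b (- x) = - K b x.
Proof.
move=> pe x1; rewrite /crit_field artanhN// exprNn -signr_odd.
have -> : odd p.-1 = true by case: p pe p3 => [//|n] /=; rewrite negbK.
by rewrite expr1; ring.
Qed.

Lemma crit_field_incr_neg b x y : odd p -> 0 < b -> -1 < x -> x < y -> y <= 0 ->
  K b x < K b y.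
Proof.
have pR := p_ge3; have [m0 m1] := andP apex_itv.
move=> po b0 x1 xy y0; apply: crit_field_incr => //; first by lra.
move=> z zxy; apply: (le_lt_trans (y := 0)); last by [].
have bp : 0 < b * p%:R * (p%:R - 1) by rewrite !mulr_gt0//; lra.
rewrite pmulr_rle0// pmulr_lle0; last by rewrite subr_gt0; nra.
have -> : z = - (- z) by rewrite opprK.
rewrite exprNn -signr_odd.
have -> : odd p.-2 = true.
  by case: p po p3 => [//|[//|n]] /=; rewrite negbK.
by rewrite expr1 mulN1r oppr_le0 exprn_ge0//; lra.
Qed.

End Shape.

(** * Local maximizers *)

Section LocalMaximizers.
#[local] Set Implicit Arguments.
#[local] Unset Strict Implicit.
Context {R : realType} {p : nat} (p3 : (3 <= p)%N).
Implicit Types (b h x y z : R).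

Let p1 : (1 < p)%N. Proof. exact: ltn_trans p3. Qed.

Local Notation m := (@apex R p).
Local Notation K b := (crit_field b p).

Lemma local_max_left b h x y : -1 <= y -> y < x -> x <= 1 ->
  (forall z, y < z < x -> h < K b z) -> ~ local_maximizer b h p x.
Proof.
move=> y1 yx x1 hK [_] /nbhs_ballP[e /= e0 xe].
pose t := Order.max ((x + y) / 2) (x - e / 2).
have [t1 t2 t3] : [/\ y < t, t < x & x - e < t].
  by rewrite !(lt_max, gt_max); split; [lra|apply/andP; split; lra|lra].
have := xe t; rewrite /ball/= in_itv/=.
move=> /(_ ltac:(rewrite gtr0_norm; lra) ltac:(lra)).
rewrite leNgt => /negP; apply; apply: H_decr => //; first by lra.
by move=> z ztx; apply: hK; lra.
Qed.

Lemma local_max_right b h x y : -1 <= x -> x < y -> y <= 1 ->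
  (forall z, x < z < y -> K b z < h) -> ~ local_maximizer b h p x.
Proof.
move=> x1 xy y1 hK [_] /nbhs_ballP[e /= e0 xe].
pose t := Order.min ((x + y) / 2) (x + e / 2).
have [t1 t2 t3] : [/\ t < y, x < t & t < x + e].
  by rewrite !(lt_min, gt_min); split; [lra|apply/andP; split; lra|lra].
have := xe t; rewrite /ball/= in_itv/=.
move=> /(_ ltac:(rewrite ltr0_norm; lra) ltac:(lra)).
rewrite leNgt => /negP; apply; apply: H_incr => //; first by lra.
by move=> z ztx; apply: hK; lra.
Qed.

(** The infinite slope of the entropy at the endpoints keeps local maximizers
    in the open interval. *)
Lemma local_max_crit b h x : local_maximizer b h p x ->
  -1 < x < 1 /\ K b x = h.
Proof.
move=> xM; have := xM.1; rewrite in_itv/= => x1.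
have {}x1 : -1 < x < 1.
  case/andP: x1 => x1 x2; rewrite !lt_neqAle x1 x2 !andbT.
  apply/andP; split; apply/eqP => xE.
    have [x0 x01 hK] := crit_field_nearN1 b p h.
    apply: (@local_max_right b h x x0) xM; rewrite -?xE; try lra.
    by move=> z zx; apply: hK; lra.
  have [x0 x01 hK] := crit_field_near1 b p h.
  apply: (@local_max_left b h x x0) xM; rewrite ?xE; try lra.
  by move=> z zx; apply: hK; lra.
split=> //.
have cK := continuous_crit_field (b := b) p1 x1.
have [hK|hK|//] := ltgtP (K b x) h.
- have /nbhs_ballP[e /= e0 xe] : \forall z \near x, K b z < h.
    by apply: (cK [set y | y < h]); exact: lt_nbhsl.
  exfalso; apply: (@local_max_right b h x (Order.min 1 (x + e))) xM; try lra.
  + by rewrite lt_min; apply/andP; split; lra.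
  + by rewrite ge_min lexx.
  + move=> z; rewrite lt_min => zx; apply: xe.
    by rewrite /ball/= ltr0_norm; lra.
- have /nbhs_ballP[e /= e0 xe] : \forall z \near x, h < K b z.
    by apply: (cK [set y | h < y]); exact: lt_nbhsr.
  exfalso; apply: (@local_max_left b h x (Order.max (-1) (x - e))) xM; try lra.
  + by rewrite le_max lexx.
  + by rewrite gt_max; apply/andP; split; lra.
  + move=> z; rewrite gt_max => zx; apply: xe.
    by rewrite /ball/= gtr0_norm; lra.
Qed.

Lemma global_local_max b h x : global_maximizer b h p x ->
  local_maximizer b h p x.
Proof.
move=> [x1 xM]; split=> //.
by apply: (@filterE _ (nbhs x)) => y; exact: xM.
Qed.

(** A rising branch crosses each of its levels once, and upwards, so that a
    point of it where the field equals [h] is a local maximizer for [h]. *)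
Definition incr_on b (u v : R) :=
  [/\ -1 <= u, v <= 1 &
      forall x y, u < x -> x < y -> y < v -> K b x < K b y].

Lemma incr_on_inj b u v x y : incr_on b u v -> u < x < v -> u < y < v ->
  K b x = K b y -> x = y.
Proof.
move=> [_ _ KI] xuv yuv xyE; have [xy|yx|//] := ltgtP x y.
- by have := KI x y ltac:(lra) xy ltac:(lra); rewrite xyE ltxx.
- by have := KI y x ltac:(lra) yx ltac:(lra); rewrite xyE ltxx.
Qed.

Lemma local_max_itv b h u v x : -1 <= u -> v <= 1 -> u < x < v ->
  (forall y, u < y < v -> H b h p y <= H b h p x) -> local_maximizer b h p x.
Proof.
move=> u1 v1 xuv xM; split; first by rewrite in_itv/=; lra.
apply: (@filterS _ (nbhs x) _ [set y | u < y < v]) => [y /= yuv _|].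
  exact: xM.
have := @near_in_itvoo R u v x; rewrite in_itv/= => /(_ xuv).
by apply: filterS => y; rewrite in_itv.
Qed.

Lemma incr_on_local_max b u v x : incr_on b u v -> u < x < v ->
  local_maximizer b (K b x) p x.
Proof.
move=> [u1 v1 KI] xuv; apply: (local_max_itv u1 v1 xuv) => y yuv.
have [xy|yx|->//] := ltgtP x y.
- by apply/ltW/H_decr => //; [lra|lra|] => z zxy; apply: KI; lra.
- by apply/ltW/H_incr => //; [lra|lra|] => z zxy; apply: KI; lra.
Qed.

Lemma incr_on_glue b u v : -1 <= u < 0 -> 0 < v <= 1 ->
  (forall x y, u < x -> x < y -> y <= 0 -> K b x < K b y) ->
  (forall x y, 0 <= x -> x < y -> y < v -> K b x < K b y) -> incr_on b u v.
Proof.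
move=> u0 v0 Kn Kp; split; [by lra|by lra|] => x y ux xy yv.
have [y0|y0] := leP y 0; first exact: Kn.
have [x0|x0] := leP 0 x; first exact: Kp.
by apply: (lt_trans (y := K b 0)); [exact: Kn|exact: Kp].
Qed.

Lemma incr_on_even b v : ~~ odd p -> 0 < v <= 1 ->
  (forall x y, 0 <= x -> x < y -> y < v -> K b x < K b y) -> incr_on b (- v) v.
Proof.
move=> pe v0 Kp; apply: incr_on_glue => //; first by lra.
move=> x y vx xy y0; rewrite -ltrN2 -!(crit_fieldN p3)//; try lra.
by apply: Kp; lra.
Qed.

Lemma incr_on_subcritical b : 0 < b <= beta_hat p -> incr_on b (-1) 1.
Proof.
move=> /[dup] bh /andP[b0 _].
have Kp x y : 0 <= x -> x < y -> y < 1 -> K b x < K b y.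
  exact: crit_field_incr_sub.
have [po|pe] := boolP (odd p); last by apply: incr_on_even => //; lra.
apply: incr_on_glue => //; try lra.
by move=> x y *; apply: crit_field_incr_neg.
Qed.

Lemma incr_on_unique_max b h : incr_on b (-1) 1 ->
  ~ more_than_one (local_maximizer b h p).
Proof.
move=> KI [x [y [/eqP xy /local_max_crit[x1 xh] /local_max_crit[y1 yh]]]].
by apply: xy; apply: (incr_on_inj KI) => //; rewrite xh yh.
Qed.

Lemma HN b h x : ~~ odd p -> H b (- h) p (- x) = H b h p x.
Proof.
move=> pe; rewrite /H /entropy exprNn -signr_odd (negbTE pe) expr0 opprK.
by ring.
Qed.

Lemma local_maxN b h x : ~~ odd p -> local_maximizer b h p x ->
  local_maximizer b (- h) p (- x).
Proof.
move=> pe [x1 /nbhs_ballP[e e0 xe]].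
split; first by move: x1; rewrite !in_itv/=; lra.
apply/nbhs_ballP; exists e => // y xy; rewrite /= in_itv/= => y1.
rewrite HN// -[y]opprK HN//; apply: xe; last by rewrite /= in_itv/=; lra.
by move: xy; rewrite /ball/= opprK -opprD normrN addrC.
Qed.

Lemma global_maxN b h x : ~~ odd p -> global_maximizer b h p x ->
  global_maximizer b (- h) p (- x).
Proof.
move=> pe [x1 xM]; split; first by move: x1; rewrite !in_itv/=; lra.
move=> y y1; rewrite HN// -[y]opprK HN//; apply: xM.
by move: y1; rewrite !in_itv/=; lra.
Qed.

Section OneShape.
Context {b a c : R} (S : @crit_shape R p b a c).

Let S0 : [/\ 0 < a, a < m, m < c & c < 1].
Proof. by case: S => /andP[? ?] /andP[? ?]. Qed.

Lemma shape_lt_crit : K b c < K b a.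
Proof. by have [a0 am mc c1] := S0; have [_ _ _ Kd _] := S; apply: Kd; lra. Qed.

Lemma shape_crit_gt0 : 0 < K b a.
Proof.
have [a0 am mc c1] := S0; have [_ _ KI _ _] := S.
by rewrite -(crit_field0 p3 b); apply: KI.
Qed.

Lemma shape_right : incr_on b c 1.
Proof.
have [a0 am mc c1] := S0; have [_ _ _ _ KI] := S.
by split=> //; [lra|] => x y cx xy y1; apply: KI => //; exact: ltW.
Qed.

(** Between [a] and [c] the field falls through its levels, at local minima of
    [H].  Near [a] it stays below its value there, near [c] above, so that [H]
    passes through these two points monotonically. *)
Lemma local_max_shape h x : local_maximizer b h p x -> ~ a <= x <= c.
Proof.
move=> xM /andP[ax xc]; have [x1 xh] := local_max_crit xM.
have [a0 am mc c1] := S0; have [_ _ _ Kd _] := S.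
move: xc; rewrite le_eqVlt => /predU1P[xc|xc].
  apply: (@local_max_left b h x a) xM; try lra.
  by move=> z zx; rewrite -xh; apply: Kd; lra.
apply: (@local_max_right b h x c) xM; try lra.
by move=> z zx; rewrite -xh; apply: Kd; lra.
Qed.

Lemma ex_crit_right h : (exists2 x, c < x < 1 & K b x = h) <-> K b c < h.
Proof.
have [a0 am mc c1] := S0; have [_ _ _ _ KI] := S; split=> [[x xc <-]|ch].
  by apply: KI; lra.
have [x0 x01 hK] := crit_field_near1 b p h.
pose y := (1 + Order.max x0 c) / 2.
have [y0 yc] : x0 < y < 1 /\ c < y.
  have : Order.max x0 c < 1 by rewrite gt_max; apply/andP; split; lra.
  have : x0 <= Order.max x0 c by rewrite le_max lexx.
  have : c <= Order.max x0 c by rewrite le_max lexx orbT.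
  by rewrite /y; lra.
have hy := hK y ltac:(lra).
have [||||x xcy xE] := @crit_field_ivt R b p h c y p1; try lra.
  by rewrite nmulr_rlt0; lra.
by exists x => //; lra.
Qed.

Section Odd.
Hypothesis (po : odd p) (b0 : 0 < b).

Lemma shape_left_odd : incr_on b (-1) a.
Proof.
have [a0 am mc c1] := S0; have [_ _ KI _ _] := S.
apply: incr_on_glue; try lra.
  by move=> x y *; apply: crit_field_incr_neg.
by move=> x y x0 xy ya; apply: KI => //; exact: ltW.
Qed.

Lemma local_max_odd h x : local_maximizer b h p x ->
  -1 < x < a \/ c < x < 1.
Proof.
move=> xM; have [x1 _] := local_max_crit xM.
have := local_max_shape xM; have [xa|ax] := ltP x a; first by left; lra.
by have [xc|cx] := leP x c => // _; right; lra.
Qed.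

Lemma multi_max_odd h x y : x < y -> local_maximizer b h p x ->
  local_maximizer b h p y -> -1 < x < a /\ c < y < 1.
Proof.
move=> xy xM yM; have [a0 am mc c1] := S0.
have [_ xh] := local_max_crit xM; have [_ yh] := local_max_crit yM.
have xyE : K b x = K b y by rewrite xh yh.
have [xp|xp] := local_max_odd xM; have [yp|yp] := local_max_odd yM => //.
- by move: xy; rewrite (incr_on_inj shape_left_odd xp yp xyE) ltxx.
- by exfalso; lra.
- by move: xy; rewrite (incr_on_inj shape_right xp yp xyE) ltxx.
Qed.

Lemma ex_crit_left_odd h : (exists2 x, -1 < x < a & K b x = h) <-> h < K b a.
Proof.
have [a0 am mc c1] := S0; have [_ _ KI] := shape_left_odd.
have KIa x : -1 < x < a -> K b x < K b a.
  move=> xa; apply: (lt_trans (y := K b ((Order.max x 0 + a) / 2))).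
    have : x <= Order.max x 0 by rewrite le_max lexx.
    have : Order.max x 0 < a by rewrite gt_max; apply/andP; split; lra.
    by move=> ? ?; apply: KI; lra.
  have : 0 <= Order.max x 0 by rewrite le_max lexx orbT.
  have : Order.max x 0 < a by rewrite gt_max; apply/andP; split; lra.
  by have [_ _ KI0 _ _] := S; move=> ? ?; apply: KI0; lra.
split=> [[x /KIa xa <-]//|ha].
have [x0 x01 hK] := crit_field_nearN1 b p h.
have hx := hK x0 ltac:(lra).
have [||||x xcy xE] := @crit_field_ivt R b p h x0 a p1; try lra.
  by rewrite pmulr_llt0; lra.
by exists x => //; lra.
Qed.

Lemma multi_local_odd h :
  more_than_one (local_maximizer b h p) <-> K b c < h < K b a.
Proof.
have [a0 am mc c1] := S0; split=> [[x [y [xy xM yM]]]|/andP[ch ha]].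
  wlog {}xy : x y xM yM {xy} / x < y.
    move=> wl; have [xy'|yx'|xyE] := ltgtP x y; first exact: (wl x y).
    - exact: (wl y x).
    - by move: xy; rewrite xyE eqxx.
  have [xp yp] := multi_max_odd xy xM yM.
  have [_ xh] := local_max_crit xM; have [_ yh] := local_max_crit yM.
  by rewrite (ex_crit_right h).1 ?(ex_crit_left_odd h).1//; [exists x|exists y].
have [x xa xh] := (ex_crit_left_odd h).2 ha.
have [y yc yh] := (ex_crit_right h).2 ch.
exists x, y; split; first by rewrite lt_eqF//; lra.
- by rewrite -xh; apply: (incr_on_local_max shape_left_odd).
- by rewrite -yh; apply: (incr_on_local_max shape_right).
Qed.

End Odd.

Section Even.
Hypothesis pe : ~~ odd p.

Lemma shape_mid_even : incr_on b (- a) a.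
Proof.
have [a0 am mc c1] := S0; have [_ _ KI _ _] := S.
apply: incr_on_even => //; first by lra.
by move=> x y x0 xy ya; apply: KI => //; exact: ltW.
Qed.

Lemma shape_left_even : incr_on b (-1) (- c).
Proof.
have [a0 am mc c1] := S0; have [_ _ KI] := shape_right.
split; [by []|by lra|] => x y x1 xy ya.
by rewrite -ltrN2 -!(crit_fieldN p3)//; [apply: KI; lra|lra|lra].
Qed.

Lemma local_max_even h x : local_maximizer b h p x ->
  [\/ -1 < x < - c, - a < x < a | c < x < 1].
Proof.
move=> xM; have [x1 _] := local_max_crit xM.
have nx : ~ a <= - x <= c := local_max_shape (local_maxN pe xM).
have := local_max_shape xM; have [xa|ax] := ltP x a; last first.
  by have [xc|cx] := leP x c => // _; constructor 3; lra.
have [ax|xa'] := ltP (- a) x; first by constructor 2; lra.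
have [cx|xc] := leP (- c) x; first by exfalso; apply: nx; lra.
by constructor 1; lra.
Qed.

Lemma ex_crit_mid_even h :
  (exists2 x, - a < x < a & K b x = h) <-> - K b a < h < K b a.
Proof.
have [a0 am mc c1] := S0; have [_ _ KI] := shape_mid_even.
have [_ _ KI0 _ _] := S.
have lt_a x : - a < x < a -> K b x < K b a.
  move=> xa; have [x0|x0] := leP 0 x; first by apply: KI0; lra.
  by apply: (lt_trans (y := K b 0)); [apply: KI; lra|apply: KI0; lra].
split=> [[x xa <-]|ha].
  have := lt_a x xa; have := lt_a (- x) ltac:(lra).
  by rewrite (crit_fieldN p3)//; lra.
have [||||x xcy xE] := @crit_field_ivt R b p h (- a) a p1; try lra.
  by rewrite (crit_fieldN p3)//; [rewrite nmulr_rlt0; lra|lra].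
by exists x.
Qed.

Lemma ex_crit_left_even h :
  (exists2 x, -1 < x < - c & K b x = h) <-> h < - K b c.
Proof.
have [a0 am mc c1] := S0.
split=> [[x xc xh]|hc].
  have : exists2 y, c < y < 1 & K b y = - h.
    by exists (- x); [lra|rewrite (crit_fieldN p3) ?xh//; lra].
  by move/(ex_crit_right (- h)).1; lra.
have [x xc xh] := (ex_crit_right (- h)).2 ltac:(lra).
by exists (- x); [lra|rewrite (crit_fieldN p3) ?xh ?opprK//; lra].
Qed.

Lemma multi_local_even h : more_than_one (local_maximizer b h p) <->
  [\/ - K b a < h < Order.min (K b a) (- K b c),
     Order.max (- K b a) (K b c) < h < K b a | K b c < h < - K b c].
Proof.
have [a0 am mc c1] := S0.
have LI := shape_left_even; have MI := shape_mid_even; have RI := shape_right.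
split=> [[x [y [xy xM yM]]]|].
  wlog {}xy : x y xM yM {xy} / x < y.
    move=> wl; have [xy'|yx'|xyE] := ltgtP x y; first exact: (wl x y).
    - exact: (wl y x).
    - by move: xy; rewrite xyE eqxx.
  have [_ xh] := local_max_crit xM; have [_ yh] := local_max_crit yM.
  have xyE : K b x = K b y by rewrite xh yh.
  have P1 z : -1 < z < - c -> K b z = h -> h < - K b c.
    by move=> zc zh; apply/ex_crit_left_even; exists z.
  have P2 z : - a < z < a -> K b z = h -> - K b a < h < K b a.
    by move=> zc zh; apply/ex_crit_mid_even; exists z.
  have P3 z : c < z < 1 -> K b z = h -> K b c < h.
    by move=> zc zh; apply/ex_crit_right; exists z.
  rewrite !(lt_min, gt_max).
  have [xp|xp|xp] := local_max_even xM; have [yp|yp|yp] := local_max_even yM;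
    try (by exfalso; lra).
  - by move: xy; rewrite (incr_on_inj LI xp yp xyE) ltxx.
  - by constructor 1; move: (P1 x xp xh) (P2 y yp yh) => -> /andP[-> ->].
  - by constructor 3; rewrite (P1 x xp xh) (P3 y yp yh).
  - by move: xy; rewrite (incr_on_inj MI xp yp xyE) ltxx.
  - by constructor 2; move: (P2 x xp xh) (P3 y yp yh) => /andP[-> ->] ->.
  - by move: xy; rewrite (incr_on_inj RI xp yp xyE) ltxx.
have two u v u' v' : incr_on b u v -> incr_on b u' v' -> v <= u' ->
    (exists2 x, u < x < v & K b x = h) -> (exists2 x, u' < x < v' & K b x = h) ->
    more_than_one (local_maximizer b h p).
  move=> I I' vu [x xp xh] [y yp yh]; exists x, y; split.
  - by rewrite lt_eqF//; lra.
  - by rewrite -xh; apply: (incr_on_local_max I).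
  - by rewrite -yh; apply: (incr_on_local_max I').
rewrite !(lt_min, gt_max).
case=> [/and3P[h1 h2 h3]|/andP[/andP[h1 h2] h3]|/andP[h1 h2]].
- apply: (two _ _ _ _ LI MI); first by lra.
    exact/ex_crit_left_even.
  by apply/ex_crit_mid_even; rewrite h1.
- apply: (two _ _ _ _ MI RI); first by lra.
    by apply/ex_crit_mid_even; rewrite h1.
  exact/ex_crit_right.
- apply: (two _ _ _ _ LI RI); first by lra.
    exact/ex_crit_left_even.
  exact/ex_crit_right.
Qed.

End Even.

End OneShape.

End LocalMaximizers.

(** * Suprema of Lipschitz families *)

Section Suprema.
#[local] Set Implicit Arguments.
#[local] Unset Strict Implicit.
Context {R : realType}.
Implicit Types (f : R -> R) (S : set R).

Lemma sup_image_max f S x : S x -> (forall y, S y -> f y <= f x) ->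
  sup (f @` S) = f x.
Proof.
move=> Sx xM; apply/eqP; rewrite eq_le; apply/andP; split.
  by apply: ge_sup; [exists (f x), x|move=> _ [y /xM + <-]].
by apply: ub_le_sup; [exists (f x) => _ [y /xM + <-]|exists x].
Qed.

(** A supremum of functions that are [k]-Lipschitz in a parameter is
    [k]-Lipschitz in that parameter. *)
Lemma continuous_sup (F : R -> R -> R) S k : S !=set0 ->
  (forall b, has_ubound (F b @` S)) ->
  (forall b b' x, S x -> `|F b x - F b' x| <= k * `|b - b'|) ->
  continuous (fun b => sup (F b @` S)).
Proof.
move=> [x0 Sx0] ubF lipF b.
have half b1 b2 : sup (F b1 @` S) <= sup (F b2 @` S) + k * `|b1 - b2|.
  apply: ge_sup; first by exists (F b1 x0), x0.
  move=> _ [y Sy <-].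
  have := ler_norm (F b1 y - F b2 y); have := lipF b1 b2 y Sy.
  have : F b2 y <= sup (F b2 @` S) by apply: ub_le_sup => //; exists y.
  lra.
apply/cvgrPdist_le => e e0.
have k0 : 0 < `|k| + 1 by have := normr_ge0 k; lra.
near=> b'.
have bb : `|b - b'| < e / (`|k| + 1).
  near: b'; apply/nbhs_ballP; exists (e / (`|k| + 1)) => //=.
  by rewrite divr_gt0.
have kb : k * `|b - b'| <= e.
  have : (`|k| + 1) * `|b - b'| <= e by rewrite mulrC -ler_pdivlMr// ltW.
  by have := ler_norm k; have := normr_ge0 (b - b'); nra.
have := half b b'; have := half b' b; rewrite [`|b' - b|]distrC.
by rewrite ler_norml; lra.
Unshelve. all: by end_near. Qed.

End Suprema.

(** * The two turning values of the critical field *)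

Section Envelopes.
#[local] Set Implicit Arguments.
#[local] Unset Strict Implicit.
Context {R : realType} {p : nat} (p3 : (3 <= p)%N).
Implicit Types (b h x y z : R).

Let p1 : (1 < p)%N. Proof. exact: ltn_trans p3. Qed.

Local Notation m := (@apex R p).
Local Notation K b := (crit_field b p).
Local Notation bh := (@beta_hat R p).

(** Above [beta_hat p] these are the local maximum and the local minimum of
    the critical field (see [upperE] and [lowerE]).  Writing them as extremal
    values over fixed sets makes their dependence on [b] evident. *)
Definition upper b : R := sup [set K b x | x in `[0, m]].
Definition lower b : R := - sup [set - K b x | x in `[m, 1[].

Lemma crit_field_dist b b' x : -1 <= x <= 1 ->
  `|K b x - K b' x| <= p%:R * `|b - b'|.
Proof.
move=> x1; have -> : K b x - K b' x = (p%:R * (b' - b)) * x ^+ p.-1.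
  by rewrite /crit_field; ring.
rewrite normrM [`|p%:R * _|]normrM distrC [`|p%:R|]ger0_norm//.
by rewrite ler_piMr ?pow_abs_le1// mulr_ge0.
Qed.

Let ub_upper b : has_ubound [set K b x | x in `[0, m]].
Proof.
have [m0 m1] := andP (@apex_itv R p p3).
exists (artanh m + `|b * p%:R|) => v [x /=]; rewrite in_itv/= => xm <-{v}.
have : artanh x <= artanh m.
  by have [->//|xm'] := eqVneq x m; apply/ltW/artanh_incr; lra.
have : - (b * p%:R * x ^+ p.-1) <= `|b * p%:R|.
  rewrite (le_trans (ler_norm _))// normrN normrM ler_piMr// pow_abs_le1//; lra.
by rewrite /crit_field; lra.
Qed.

Let ub_lower b : has_ubound [set - K b x | x in `[m, 1[].
Proof.
have [m0 m1] := andP (@apex_itv R p p3).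
exists `|b * p%:R| => v [x /=]; rewrite in_itv/= => xm <-{v}.
have : b * p%:R * x ^+ p.-1 <= `|b * p%:R|.
  rewrite (le_trans (ler_norm _))// normrM ler_piMr// pow_abs_le1//; lra.
have := @artanh_ge0 R x ltac:(lra).
by rewrite /crit_field; lra.
Qed.

Lemma continuous_upper : continuous upper.
Proof.
have [m0 m1] := andP (@apex_itv R p p3).
apply: (@continuous_sup R (fun b x => K b x) _ p%:R).
- by exists 0; rewrite /= in_itv/= lexx ltW.
- exact: ub_upper.
- by move=> b b' x /=; rewrite in_itv/= => xm; apply: crit_field_dist; lra.
Qed.

Lemma continuous_lower : continuous lower.
Proof.
have [m0 m1] := andP (@apex_itv R p p3).
move=> b; apply: cvgN; move: b.
apply: (@continuous_sup R (fun b x => - K b x) _ p%:R).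
- by exists m; rewrite /= in_itv/= lexx.
- exact: ub_lower.
- move=> b b' x /=; rewrite in_itv/= => xm.
  by rewrite -opprD normrN; apply: crit_field_dist; lra.
Qed.

Lemma le_upper b x : 0 <= x <= m -> K b x <= upper b.
Proof. by move=> xm; apply: ub_le_sup => //; exists x. Qed.

Lemma ge_lower b x : m <= x < 1 -> lower b <= K b x.
Proof.
move=> xm; rewrite /lower lerNl.
by apply: (@ub_le_sup _ [set - K b x | x in `[m, 1[]) => //; exists x.
Qed.

Lemma upperE b a c : @crit_shape R p b a c -> upper b = K b a.
Proof.
case=> /andP[a0 am] /andP[mc c1] KI Kd _; apply: sup_image_max.
  by rewrite /= in_itv/= !ltW.
move=> y /=; rewrite in_itv/= => ym; have [ya|ay|->//] := ltgtP y a.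
  by apply/ltW/KI; lra.
by apply/ltW/Kd; lra.
Qed.

Lemma lowerE b a c : @crit_shape R p b a c -> lower b = K b c.
Proof.
case=> /andP[a0 am] /andP[mc c1] _ Kd KI.
rewrite /lower (@sup_image_max _ (fun x => - K b x) _ c) ?opprK//.
  by rewrite /= in_itv/= c1 ltW.
move=> y /=; rewrite in_itv/= lerN2 => ym; have [yc|cy|->//] := ltgtP y c.
  by apply/ltW/Kd; lra.
by apply/ltW/KI; lra.
Qed.

Lemma upper_hat : upper bh = h_hat p.
Proof.
have [m0 m1] := andP (@apex_itv R p p3).
rewrite h_hatE//; apply: sup_image_max; first by rewrite /= in_itv/= lexx ltW.
move=> y /=; rewrite in_itv/= => ym; have [->//|ym'] := eqVneq y m.
apply/ltW/crit_field_incr_sub => //; rewrite ?lexx ?beta_hat_gt0//; lra.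
Qed.

Lemma lower_hat : lower bh = h_hat p.
Proof.
have [m0 m1] := andP (@apex_itv R p p3).
rewrite h_hatE// /lower (@sup_image_max _ (fun x => - K bh x) _ m) ?opprK//.
  by rewrite /= in_itv/= lexx.
move=> y /=; rewrite in_itv/= lerN2 => ym; have [->//|ym'] := eqVneq y m.
apply/ltW/crit_field_incr_sub => //; rewrite ?lexx ?beta_hat_gt0//; lra.
Qed.

Lemma h_hat_gt0 : 0 < h_hat p :> R.
Proof.
have [m0 m1] := andP (@apex_itv R p p3).
rewrite h_hatE// -(crit_field0 p3 bh).
by apply: crit_field_incr_sub => //; rewrite lexx beta_hat_gt0.
Qed.

Lemma crit_field_decr_b b b' x : 0 < x -> b < b' -> K b' x < K b x.
Proof.
move=> x0 bb; rewrite /crit_field ltrD2l ltrN2 ltr_pM2r ?exprn_gt0//.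
by rewrite ltr_pM2r// ltr0n; exact: ltn_trans p1.
Qed.

Lemma upper_decr b b' : bh < b -> b < b' -> upper b' < upper b.
Proof.
move=> hb bb; have [a [c S]] := shape_ex p3 (lt_trans hb bb).
rewrite (upperE S); have [/andP[a0 am] _ _ _ _] := S.
apply: (lt_le_trans (crit_field_decr_b a0 bb)).
by apply: le_upper; rewrite !ltW.
Qed.

Lemma lower_decr b b' : bh < b -> b < b' -> lower b' < lower b.
Proof.
move=> hb bb; have [a [c S]] := shape_ex p3 hb.
rewrite (lowerE S); have [m0 m1] := andP (@apex_itv R p p3).
have [_ /andP[mc c1] _ _ _] := S.
apply: le_lt_trans (crit_field_decr_b (x := c) _ bb); last by lra.
by apply: ge_lower; rewrite c1 ltW.
Qed.

Lemma lower_lt_upper b : bh < b -> lower b < upper b.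
Proof.
move=> hb; have [a [c S]] := shape_ex p3 hb.
by rewrite (lowerE S) (upperE S) (shape_lt_crit S).
Qed.

Lemma upper_gt0 b : bh < b -> 0 < upper b.
Proof.
move=> hb; have [a [c S]] := shape_ex p3 hb.
by rewrite (upperE S) (shape_crit_gt0 p3 S).
Qed.

(** For [x <= tanh e] the field is at most [artanh x <= e]; on the rest of
    [ [0, m] ] it is not positive once [b] is large. *)
Lemma upper_cvg0 : upper b @[b --> +oo] --> (0 : R).
Proof.
have [m0 m1] := andP (@apex_itv R p p3).
suff small (e : R) : 0 < e -> \forall b \near +oo, `|upper b| <= e.
  by apply/cvgr0Pnorm_le => e; exact: small.
move=> e0; have [t1 t2] := andP (tanh_itv e).
have te : artanh (tanh e) = e by exact: tanhK.
have t0 : 0 < tanh e.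
  rewrite ltNge; apply/negP; rewrite le_eqVlt => /predU1P[tht0|tht0].
    by move: te; rewrite tht0 artanh0; lra.
  by have := artanh_incr t1 tht0 ltac:(lra); rewrite te artanh0; lra.
have am : 0 <= artanh m by apply: artanh_ge0; lra.
have pt0 : 0 < p%:R * tanh e ^+ p.-1.
  by rewrite mulr_gt0 ?exprn_gt0// ltr0n; exact: ltn_trans p1.
near=> b.
have hb : bh < b by near: b; apply: nbhs_pinfty_gt; exact: num_real.
have b0 : 0 < b := lt_trans (beta_hat_gt0 p3) hb.
have bt : artanh m <= b * (p%:R * tanh e ^+ p.-1).
  by rewrite -ler_pdivrMr//; near: b; apply: nbhs_pinfty_ge; exact: num_real.
have [a [c S]] := shape_ex p3 hb; have u0 := upper_gt0 hb.
rewrite (ger0_norm (ltW u0)) (upperE S); have [/andP[a0 aM] _ _ _ _] := S.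
have [at_|ta] := leP a (tanh e).
  have : artanh a <= e.
    rewrite -te; have [->//|at'] := eqVneq a (tanh e).
    by apply/ltW/artanh_incr; lra.
  have : 0 <= b * p%:R * a ^+ p.-1 by rewrite !mulr_ge0// ?exprn_ge0// ltW.
  by rewrite /crit_field; lra.
have : artanh a < artanh m by apply: artanh_incr; lra.
have : b * (p%:R * tanh e ^+ p.-1) <= b * p%:R * a ^+ p.-1.
  rewrite mulrA ler_wpM2l//; first by rewrite mulr_ge0// ltW.
  by rewrite lerXn2r// ?nnegrE ltW// (lt_trans t0).
by rewrite /crit_field; lra.
Unshelve. all: by end_near. Qed.

Lemma lower_cvgNy : lower b @[b --> +oo] --> -oo.
Proof.
have [m0 m1] := andP (@apex_itv R p p3).
have pm0 : 0 < p%:R * m ^+ p.-1.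
  by rewrite mulr_gt0 ?exprn_gt0// ltr0n; exact: ltn_trans p1.
apply/cvgrNyPle => M; near=> b.
have lm : lower b <= K b m by apply: ge_lower; rewrite lexx.
apply: (le_trans lm).
rewrite /crit_field lerBlDr -lerBlDl -mulrA -(ler_pdivrMr _ _ pm0).
by near: b; apply: nbhs_pinfty_ge; exact: num_real.
Unshelve. all: by end_near. Qed.

End Envelopes.

(** * The coexistence curve *)

Section Coexistence.
#[local] Set Implicit Arguments.
#[local] Unset Strict Implicit.
Context {R : realType} {p : nat} (p3 : (3 <= p)%N).
Implicit Types (b h x y z s : R).

Let p1 : (1 < p)%N. Proof. exact: ltn_trans p3. Qed.
Let p0 : (0 < p)%N. Proof. exact: ltn_trans p1. Qed.

Local Notation m := (@apex R p).
Local Notation K b := (crit_field b p).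
Local Notation H b h := (H b h p).
Local Notation bh := (@beta_hat R p).
Local Notation U := (@upper R p).
Local Notation L := (@lower R p).

Definition peak lo hi b h : R := sup [set H b h x | x in `[lo, hi]].

(** Two maximizers of [H] on opposite sides of [m] coexist where the gap
    vanishes. *)
Definition gap s b h : R := peak m 1 b h - peak s m b h.

(** The left end of the interval is -1 for odd [p] and 0 for even [p].  For
    even [p] and nonnegative [h] the maximum over [-1, 1] is attained on [0, 1],
    and there [H] has the shape it has on [-1, 1] for odd [p]. *)
Definition left_end s := s = 0 \/ s = -1 /\ odd p.

Lemma peak_attained lo hi b h : lo <= hi -> exists x, [/\ lo <= x <= hi,
  peak lo hi b h = H b h x & forall y, lo <= y <= hi -> H b h y <= H b h x].
Proof.
move=> lh; have [x] := EVT_max lh (continuous_subspaceT (@continuous_H R b h p)).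
rewrite in_itv/= => xlh xM.
have {}xM y : lo <= y <= hi -> H b h y <= H b h x.
  by move=> ylh; apply: xM; rewrite in_itv.
exists x; split=> //; apply: sup_image_max => [|y /=]; rewrite /= in_itv//=.
exact: xM.
Qed.

Lemma le_peak lo hi b h y : lo <= y <= hi -> H b h y <= peak lo hi b h.
Proof.
move=> ylh; have [|x [_ -> xM]] := @peak_attained lo hi b h; last exact: xM.
by lra.
Qed.

Let ub_peak lo hi b h : has_ubound [set H b h x | x in `[lo, hi]].
Proof.
have [lh|hl] := leP lo hi.
  have [x [_ _ xM]] := peak_attained b h lh.
  by exists (H b h x) => v [y /=]; rewrite in_itv/= => /xM + <-{v}.
by exists 0 => v [y /=]; rewrite in_itv/= => ?; exfalso; lra.
Qed.

Lemma continuous_peak_beta lo hi h : -1 <= lo -> lo <= hi -> hi <= 1 ->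
  continuous (fun b => peak lo hi b h).
Proof.
move=> lo1 lh hi1; apply: (@continuous_sup R (fun b x => H b h x) _ 1) => [|//|].
  by exists lo; rewrite /= in_itv/= lexx.
move=> b b' x /=; rewrite in_itv/= => xlh.
have -> : H b h x - H b' h x = (b - b') * x ^+ p by rewrite /Defs.H; ring.
by rewrite normrM mul1r ler_piMr// pow_abs_le1//; lra.
Qed.

Lemma continuous_peak_field lo hi b : -1 <= lo -> lo <= hi -> hi <= 1 ->
  continuous (peak lo hi b).
Proof.
move=> lo1 lh hi1; apply: (@continuous_sup R (fun h x => H b h x) _ 1) => [|//|].
  by exists lo; rewrite /= in_itv/= lexx.
move=> h h' x /=; rewrite in_itv/= => xlh.
have -> : H b h x - H b h' x = (h - h') * x by rewrite /Defs.H; ring.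
by rewrite normrM mul1r ler_piMr// ler_norml; lra.
Qed.

Lemma H0 b h : H b h 0 = 0.
Proof.
rewrite /Defs.H /entropy expr0n gtn_eqF// addr0 subr0 ln1 !mulr0 addr0.
by rewrite mul0r subrr.
Qed.

Lemma entropy_ge0 x : -1 <= x <= 1 -> 0 <= entropy x.
Proof.
have HE y : Defs.H 0 0 p y = - entropy y by rewrite /Defs.H !mul0r add0r sub0r.
have KE y : crit_field 0 p y = artanh y.
  by rewrite /crit_field !mul0r subr0.
move=> x1; rewrite -oppr_le0 -HE -[leRHS](H0 0 0).
have [x0|x0|->//] := ltgtP x 0.
- apply/ltW/H_incr => //; first by lra.
  by move=> z zx; rewrite KE -artanh0; apply: artanh_incr; lra.
- apply/ltW/H_decr => //; first by lra.
  by move=> z zx; rewrite KE -artanh0; apply: artanh_incr; lra.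
Qed.

Section LeftEnd.
Context {s : R} (sP : left_end s).

Let s0 : -1 <= s <= 0.
Proof. by case: sP => [->|[-> _]]; lra. Qed.

Lemma left_end_expr_lt x y : s <= y -> y < x -> 0 <= x -> y ^+ p < x ^+ p.
Proof.
move=> sy yx x0; have [y0|y0] := leP 0 y.
  by rewrite ltr_pXn2r// nnegrE.
case: sP => [sE|[_ po]]; first by exfalso; lra.
apply: (lt_le_trans (y := 0)); last exact: exprn_ge0.
by rewrite exprn_odd_lt0.
Qed.

Lemma left_end_expr_le x y : s <= y -> y <= x -> 0 <= x -> y ^+ p <= x ^+ p.
Proof.
move=> sy; rewrite le_eqVlt => /predU1P[->//|yx] x0.
exact/ltW/left_end_expr_lt.
Qed.

Lemma continuous_gap_beta h : continuous (fun b => gap s b h).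
Proof.
have [m0 m1] := andP (@apex_itv R p p3); have [sl sr] := andP s0.
by move=> b; apply: cvgB; apply: continuous_peak_beta; lra.
Qed.

Lemma continuous_gap_field b : continuous (gap s b).
Proof.
have [m0 m1] := andP (@apex_itv R p p3); have [sl sr] := andP s0.
by move=> h; apply: cvgB; apply: continuous_peak_field; lra.
Qed.

(** Testing the peaks at [(b', h')] and [(b, h)] with each other's maximizers:
    raising [b] or [h] favours the right side. *)
Lemma gap_diff b h b' h' : exists x y, [/\ m <= x <= 1 /\ s <= y <= m,
  H b h x = peak m 1 b h, H b' h' y = peak s m b' h' &
  gap s b h + (b' - b) * (x ^+ p - y ^+ p) + (h' - h) * (x - y)
    <= gap s b' h'].
Proof.
have [m0 m1] := andP (@apex_itv R p p3); have [sl sr] := andP s0.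
have [|x [xm xE _]] := @peak_attained m 1 b h; first exact: ltW.
have [|y [ym yE _]] := @peak_attained s m b' h'; first by lra.
exists x, y; split=> //.
have := le_peak b' h' xm; have := le_peak b h ym.
rewrite /gap xE yE.
have -> : H b' h' x = H b h x + (b' - b) * x ^+ p + (h' - h) * x.
  by rewrite /Defs.H; ring.
have -> : H b h y = H b' h' y - (b' - b) * y ^+ p - (h' - h) * y.
  by rewrite /Defs.H; ring.
by lra.
Qed.

Lemma apex_not_local_max b h : bh < b -> ~ local_maximizer b h p m.
Proof.
move=> hb mM; have [a [c S]] := shape_ex p3 hb.
apply: (local_max_shape p3 S mM).
by have [/andP[_ am] /andP[mc _] _ _ _] := S; rewrite !ltW.
Qed.

(** At zero gap, the turning point [m] cannot be the best point of either
    side, since it would then be a local maximizer. *)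
Lemma gap0_neq_apex b h x : bh < b -> gap s b h = 0 ->
  H b h x = peak m 1 b h \/ H b h x = peak s m b h -> x != m.
Proof.
have [m0 m1] := andP (@apex_itv R p p3); have [sl sr] := andP s0.
move=> hb /eqP; rewrite subr_eq0 => /eqP D0 xE; apply/eqP => xm.
have xM : H b h m = peak s m b h by case: xE; rewrite xm// D0.
apply: (@apex_not_local_max b h hb).
apply: (@local_max_itv R p b h s 1 m); [lra|by []|lra|] => y y1.
rewrite xM; have [ym|my] := leP y m; first by apply: le_peak; lra.
by rewrite -D0; apply: le_peak; lra.
Qed.

Lemma gap0_lt b h b' h' : bh < b -> gap s b h = 0 -> b <= b' -> h <= h' ->
  b < b' \/ h < h' -> 0 < gap s b' h'.
Proof.
have [m0 m1] := andP (@apex_itv R p p3).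
move=> hb D0 bb hh lt_bh; have [x [y [[xm ym] xE yE]]] := gap_diff b h b' h'.
rewrite D0 add0r; apply: lt_le_trans.
have xm' : x != m by apply: (gap0_neq_apex hb D0); left.
have yx : y < x by move: xm'; rewrite neq_lt => /orP[]; lra.
have yxp : y ^+ p < x ^+ p by apply: left_end_expr_lt => //; lra.
by case: lt_bh; nra.
Qed.

Lemma lt_gap0 b h b' h' : bh < b' -> gap s b' h' = 0 -> b <= b' -> h <= h' ->
  b < b' \/ h < h' -> gap s b h < 0.
Proof.
have [m0 m1] := andP (@apex_itv R p p3).
move=> hb D0 bb hh lt_bh; have [x [y [[xm ym] xE yE]]] := gap_diff b h b' h'.
rewrite D0 => gap0; rewrite ltNge; apply/negP => gap1; move: gap0.
apply/negP; rewrite -ltNge -addrA ltr_wpDl//.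
have ym' : y != m by apply: (gap0_neq_apex hb D0); right.
have yx : y < x by move: ym'; rewrite neq_lt => /orP[]; lra.
have yxp : y ^+ p < x ^+ p by apply: left_end_expr_lt => //; lra.
by case: lt_bh; nra.
Qed.

(** At [h = lower b] the function [H] decreases right of [m], while it still
    exceeds [H m] left of it; at [h = upper b] the roles are exchanged. *)
Lemma gap_lower b : bh < b -> gap s b (L b) < 0.
Proof.
move=> hb; have [a [c S]] := shape_ex p3 hb; rewrite (lowerE S).
have [/andP[a0 am] /andP[mc c1] _ Kd KI] := S; have [sl sr] := andP s0.
rewrite subr_lt0; apply: (le_lt_trans (y := H b (K b c) m)).
  have [|x [xm -> _]] := @peak_attained m 1 b (K b c); first by lra.
  have [xc|cx] := leP x c.
    have [->//|xm'] := eqVneq x m; apply/ltW/H_decr; try lra.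
    by move=> z zx; apply: Kd; lra.
  apply: (le_trans (y := H b (K b c) c)).
    by apply/ltW/H_decr; try lra; move=> z zx; apply: KI; lra.
  by apply/ltW/H_decr; try lra; move=> z zx; apply: Kd; lra.
apply: (lt_le_trans (y := H b (K b c) a)); last by apply: le_peak; lra.
by apply: H_decr; try lra; move=> z zx; apply: Kd; lra.
Qed.

Lemma gap_upper b : bh < b -> 0 < gap s b (U b).
Proof.
move=> hb; have [a [c S]] := shape_ex p3 hb; rewrite (upperE S).
have [/andP[a0 am] /andP[mc c1] KI Kd _] := S; have [sl sr] := andP s0.
have b0 : 0 < b := lt_trans (beta_hat_gt0 p3) hb.
have Ka z : s < z -> z < a -> K b z < K b a.
  move=> sz za; have [z0|z0] := leP 0 z; first exact: KI.
  case: sP => [sE|[sE po]]; first by exfalso; lra.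
  by apply/(ex_crit_left_odd p3 S po b0); exists z => //; lra.
rewrite subr_gt0; apply: (le_lt_trans (y := H b (K b a) m)).
  have [|x [xm -> _]] := @peak_attained s m b (K b a); first by lra.
  have [ax|xa] := leP a x.
    have [->//|xm'] := eqVneq x m; apply/ltW/H_incr; try lra.
    by move=> z zx; apply: Kd; lra.
  apply: (le_trans (y := H b (K b a) a)).
    by apply/ltW/H_incr; try lra; move=> z zx; apply: Ka; lra.
  by apply/ltW/H_incr; try lra; move=> z zx; apply: Kd; lra.
apply: (lt_le_trans (y := H b (K b a) c)); last by apply: le_peak; lra.
by apply: H_incr; try lra; move=> z zx; apply: Kd; lra.
Qed.

(** The zero exists and is unique for [beta_hat p < b], see [gap_coex] and
    [gap_eq0]. *)
Definition coex b : R := xget 0 [set h | gap s b h = 0].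

Lemma gap_coex b : bh < b -> gap s b (coex b) = 0.
Proof.
move=> hb; rewrite /coex; case: xgetP => [h _ //|noh].
have lu := lower_lt_upper p3 hb.
have := gap_lower hb; have := gap_upper hb => gu gl.
have [||h _ h0] := @IVT R (gap s b) (L b) (U b) 0 (ltW lu).
- exact/continuous_subspaceT/continuous_gap_field.
- by rewrite ge_min le_max (ltW gl) (ltW gu) orbT.
- by case: (noh h).
Qed.

Lemma gap_gt0 b h : bh < b -> (0 < gap s b h) = (coex b < h).
Proof.
move=> hb; have D0 := gap_coex hb; have [ch|hc|<-] := ltgtP (coex b) h.
- by apply: (gap0_lt hb D0) => //; [exact: ltW|right].
- by apply/negbTE; rewrite -leNgt ltW// (lt_gap0 hb D0)//; [exact: ltW|right].
- by rewrite D0 ltxx.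
Qed.

Lemma gap_lt0 b h : bh < b -> (gap s b h < 0) = (h < coex b).
Proof.
move=> hb; have D0 := gap_coex hb; have [ch|hc|<-] := ltgtP (coex b) h.
- by apply/negbTE; rewrite -leNgt ltW// gap_gt0.
- by apply: (lt_gap0 hb D0) => //; [exact: ltW|right].
- by rewrite D0 ltxx.
Qed.

Lemma gap_eq0 b h : bh < b -> gap s b h = 0 -> h = coex b.
Proof.
move=> hb D0; have := gap_gt0 h hb; have := gap_lt0 h hb.
by rewrite D0 ltxx; case: ltgtP.
Qed.

Lemma coex_itv b : bh < b -> L b < coex b < U b.
Proof.
by move=> hb; rewrite -gap_lt0// -gap_gt0// gap_lower// gap_upper.
Qed.

Lemma coex_decr b b' : bh < b -> b < b' -> coex b' < coex b.
Proof.
move=> hb bb; rewrite -gap_gt0; last exact: lt_trans bb.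
by apply: (gap0_lt hb (gap_coex hb)) => //; [exact: ltW|left].
Qed.

(** Continuity comes from the sign of the gap at [coex b + e] and
    [coex b - e], which persists for nearby values of [b]. *)
Lemma continuous_coex b : bh < b -> {for b, continuous coex}.
Proof.
move=> hb; apply/cvgrPdist_le => e e0; near=> b'.
have hb' : bh < b' by near: b'; exact: lt_nbhsr.
have : coex b - e < coex b'.
  rewrite -gap_lt0//; near: b'.
  apply: (@continuous_gap_beta (coex b - e) b [set g | g < 0]).
  by apply: lt_nbhsl; rewrite gap_lt0//; lra.
have : coex b' < coex b + e.
  rewrite -gap_gt0//; near: b'.
  apply: (@continuous_gap_beta (coex b + e) b [set g | 0 < g]).
  by apply: lt_nbhsr; rewrite gap_gt0//; lra.
by rewrite ler_norml; lra.
Unshelve. all: by end_near. Qed.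

(** For large [b] the endpoint 1 alone beats every point left of [m]. *)
Lemma gap_large h : \forall b \near +oo, 0 < gap s b h.
Proof.
have [m0 m1] := andP (@apex_itv R p p3); have [sl sr] := andP s0.
have mp : 0 < 1 - m ^+ p by rewrite subr_gt0 exprn_ilt1 -?lt0n// ltW.
near=> b.
have b0 : 0 < b by near: b; apply: nbhs_pinfty_gt; exact: num_real.
have bl : `|h| - h + entropy 1 < b * (1 - m ^+ p).
  rewrite -(ltr_pdivrMr _ _ mp); near: b.
  by apply: nbhs_pinfty_gt; exact: num_real.
have r1 : H b h 1 <= peak m 1 b h by apply: le_peak; lra.
have [|y [ym yE _]] := @peak_attained s m b h; first by lra.
rewrite subr_gt0 yE; apply: lt_le_trans r1.
have yp : y ^+ p <= m ^+ p by apply: left_end_expr_le; lra.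
have byp : b * y ^+ p <= b * m ^+ p by rewrite ler_wpM2l// ltW.
have hy : h * y <= `|h|.
  by rewrite (le_trans (ler_norm _))// normrM ler_piMr// ler_norml; lra.
have := @entropy_ge0 y ltac:(lra).
by rewrite /Defs.H expr1n; lra.
Unshelve. all: by end_near. Qed.

Lemma coex_cvgNy : coex b @[b --> +oo] --> -oo.
Proof.
apply/cvgrNyPle => M; near=> b; apply: ltW; rewrite -gap_gt0.
  by near: b; exact: gap_large.
by near: b; apply: nbhs_pinfty_gt; exact: num_real.
Unshelve. all: by end_near. Qed.

Lemma H_subcritical_lt0 b x : 0 < b <= bh -> 0 < x <= 1 -> H b 0 x < 0.
Proof.
move=> hb x1; rewrite -[ltRHS](H0 b 0); apply: H_decr; try lra.
move=> z zx; rewrite -(crit_field0 p3 b).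
by apply: crit_field_incr_sub => //; lra.
Qed.

Lemma coex_root : exists2 b, bh < b & coex b = 0.
Proof.
have [m0 m1] := andP (@apex_itv R p p3); have [sl sr] := andP s0.
have bh0 := beta_hat_gt0 (R := R) p3.
have hat : gap s bh 0 < 0.
  rewrite subr_lt0; apply: (lt_le_trans (y := H bh 0 0)).
    have [|x [xm -> _]] := @peak_attained m 1 bh 0; first by lra.
    by rewrite H0; apply: H_subcritical_lt0; [rewrite lexx bh0|lra].
  by apply: le_peak; lra.
have [B [hB gB]] : exists B, bh < B /\ 0 < gap s B 0.
  apply: (@filter_ex _ (+oo : set_system R)).
  near=> B; split; last by near: B; exact: gap_large.
  by near: B; apply: nbhs_pinfty_gt; exact: num_real.
have [||b] := @IVT R (fun b => gap s b 0) bh B 0 (ltW hB).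
- exact/continuous_subspaceT/continuous_gap_beta.
- by rewrite ge_min le_max (ltW hat) (ltW gB) orbT.
rewrite in_itv/= => /andP[hb bB] b0.
have {}hb : bh < b.
  by rewrite lt_neqAle hb andbT; apply/eqP => bE; move: hat; rewrite bE b0 ltxx.
by exists b => //; rewrite -(gap_eq0 hb b0).
Unshelve. all: by end_near. Qed.

Lemma gap0_maximizers b h : bh < b -> gap s b h = 0 -> exists x y,
  [/\ s <= x < m, m < y <= 1, H b h x = H b h y &
      forall z, s <= z <= 1 -> H b h z <= H b h x].
Proof.
have [m0 m1] := andP (@apex_itv R p p3); have [sl sr] := andP s0.
move=> hb D0; have [|x [xm xE _]] := @peak_attained s m b h; first by lra.
have [|y [ym yE _]] := @peak_attained m 1 b h; first by lra.
have xm' : x != m by apply: (gap0_neq_apex hb D0); right.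
have ym' : y != m by apply: (gap0_neq_apex hb D0); left.
have E : peak m 1 b h = peak s m b h by apply/eqP; rewrite -subr_eq0; apply/eqP.
exists x, y; split; [by lra|by lra|by rewrite -xE -yE|] => z z1.
rewrite -xE; have [zm|mz] := leP z m; first by apply: le_peak; lra.
by rewrite -E; apply: le_peak; lra.
Qed.

Lemma gap0_of_maximizers b h x y : s <= x <= m -> m <= y <= 1 ->
  (forall z, s <= z <= 1 -> H b h z <= H b h x) ->
  (forall z, s <= z <= 1 -> H b h z <= H b h y) -> gap s b h = 0.
Proof.
have [m0 m1] := andP (@apex_itv R p p3); have [sl sr] := andP s0.
move=> xm ym xM yM; rewrite /gap.
have -> : peak s m b h = H b h x.
  apply: sup_image_max => [|z /=]; rewrite /= in_itv/= => // zm.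
  by apply: xM; lra.
have -> : peak m 1 b h = H b h y.
  apply: sup_image_max => [|z /=]; rewrite /= in_itv/= => // zm.
  by apply: yM; lra.
by apply/eqP; rewrite subr_eq0 eq_le xM ?yM; lra.
Qed.

(** If the left side wins at [h = 0], then 0 is the winner: the only critical
    point left of [a] is 0. *)
Lemma H_le0_coex b : bh < b ->
  (forall x, 0 <= x <= 1 -> H b 0 x <= 0) <-> 0 <= coex b.
Proof.
have [m0 m1] := andP (@apex_itv R p p3); have [sl sr] := andP s0.
move=> hb; rewrite leNgt -gap_gt0// -leNgt subr_le0; split=> [H_le0|lr].
  have [|x [xm -> _]] := @peak_attained m 1 b 0; first by lra.
  apply: (le_trans (y := H b 0 0)); first by rewrite H0 H_le0//; lra.
  by apply: le_peak; lra.
have [|x [xm xE _]] := @peak_attained s m b 0; first by lra.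
have xM z : s <= z <= 1 -> H b 0 z <= H b 0 x.
  move=> z1; rewrite -xE; have [zm|mz] := leP z m; first by apply: le_peak; lra.
  by apply: le_trans lr; apply: le_peak; lra.
suff x0 : x = 0 by move=> z z1; have := xM z ltac:(lra); rewrite x0 H0.
have [a [c S]] := shape_ex p3 hb; have [/andP[a0 am] /andP[mc c1] KI _ _] := S.
have crit : local_maximizer b 0 p x -> 0 <= x -> x = 0.
  move=> xL x0; have [_ xK] := local_max_crit p3 xL.
  have xa : x < a.
    by rewrite ltNge; apply/negP => ?; apply: (local_max_shape p3 S xL); lra.
  have [//|x0'] := eqVneq x 0.
  by have := KI 0 x (lexx _) ltac:(lra) (ltW xa); rewrite xK crit_field0// ltxx.
have [sE|[sE po]] := sP.
  have [->//|x0'] := eqVneq x 0; apply: crit; last by lra.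
  by apply: (@local_max_itv R p b 0 0 1 x); try lra; move=> y y1; apply: xM; lra.
have xL : local_maximizer b 0 p x.
  apply: global_local_max; split; first by rewrite in_itv/=; lra.
  by move=> y; rewrite in_itv/= => y1; apply: xM; lra.
have [x0|x0] := leP 0 x; first exact: crit.
have [x1 xK] := local_max_crit p3 xL.
have b0 : 0 < b := lt_trans (beta_hat_gt0 p3) hb.
have := crit_field_incr_neg p3 po b0 (x := x) ltac:(lra) x0 (lexx _).
by rewrite xK crit_field0// ltxx.
Qed.

Lemma beta_tildeE b : bh < b -> coex b = 0 -> beta_tilde p = b.
Proof.
move=> hb b0; have bh0 := beta_hat_gt0 (R := R) p3.
have supE b' : (forall x, 0 <= x <= 1 -> H b' 0 x <= 0) <->
    sup [set H b' 0 x | x in `[0, 1]] = 0.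
  split=> [H_le0|supE x x01].
    rewrite -[RHS](H0 b' 0); apply: sup_image_max => [|x /=]; rewrite /= in_itv/=.
      by rewrite lexx ler01.
    by move=> x01; rewrite H0 H_le0.
  by have := le_peak b' 0 x01; rewrite /peak supE.
rewrite /beta_tilde; rewrite -[RHS](@sup_image_max R id [set b' | 0 < b' <= b] b).
- congr sup; apply/seteqP.
  split=> [b' [b'0 /supE H_le0]|_ [b' /= /andP[b'0 b'b] <-]].
    exists b' => //=; rewrite b'0 leNgt; apply/negP => bb'.
    have hb' := lt_trans hb bb'.
    by have := coex_decr hb bb'; rewrite b0 ltNge (H_le0_coex hb').1.
  split=> //; apply/supE; have [b'h|hb'] := leP b' bh.
    move=> x x01; have [->|x0] := eqVneq x 0; first by rewrite H0.
    by apply/ltW/H_subcritical_lt0; [rewrite b'0|lra].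
  apply/(H_le0_coex hb'); rewrite -b0; have [->//|bb'] := eqVneq b' b.
  by apply/ltW/coex_decr => //; lra.
- by rewrite /= lexx andbT; lra.
- by move=> b' /= /andP[].
Qed.

End LeftEnd.

(** * Points with several global maximizers *)

Lemma multi_global_odd b h : odd p -> bh < b ->
  more_than_one (global_maximizer b h p) <-> h = @coex (-1) b.
Proof.
move=> po hb; have sP : left_end (-1) by right.
have [a [c S]] := shape_ex p3 hb; have [/andP[a0 am] /andP[mc c1] _ _ _] := S.
have b0 : 0 < b := lt_trans (beta_hat_gt0 p3) hb.
split=> [[x [y [xy xM yM]]]|->].
  wlog {}xy : x y xM yM {xy} / x < y.
    move=> wl; have [xy'|yx'|xyE] := ltgtP x y; first exact: (wl x y).
    - exact: (wl y x).
    - by move: xy; rewrite xyE eqxx.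
  have [xa yc] := multi_max_odd p3 S po b0 xy (global_local_max xM)
    (global_local_max yM).
  apply: (gap_eq0 sP hb); apply: (@gap0_of_maximizers _ sP b h x y); try lra.
  - by move=> z z1; apply: xM.2; rewrite in_itv.
  - by move=> z z1; apply: yM.2; rewrite in_itv.
have [x [y [xm ym xyE xM]]] := gap0_maximizers sP hb (gap_coex sP hb).
exists x, y; split; first by rewrite lt_eqF//; lra.
- by split; [rewrite in_itv/=; lra|move=> z; rewrite in_itv/=; exact: xM].
- split; first by rewrite in_itv/=; lra.
  by move=> z; rewrite in_itv/= -xyE; exact: xM.
Qed.

Section EvenGlobal.
Hypothesis pe : ~~ odd p.

Lemma HN_sub b h x : H b h (- x) = H b h x - 2 * h * x.
Proof.
have := HN b h (- x) pe; rewrite opprK => <-.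
by rewrite /Defs.H; ring.
Qed.

Lemma even_global b h x : 0 <= h -> 0 <= x <= 1 ->
  (forall z, 0 <= z <= 1 -> H b h z <= H b h x) -> global_maximizer b h p x.
Proof.
move=> h0 x01 xM; split; first by rewrite in_itv/=; lra.
move=> y; rewrite in_itv/= => y1; have [y0|y0] := leP 0 y; first by apply: xM; lra.
apply: (le_trans (y := H b h (- y))); last by apply: xM; lra.
by rewrite HN_sub; nra.
Qed.

(** For [h > 0] reflection improves negative points, so the comparison takes
    place on [0, 1].  At [h = 0] a nonzero global maximizer has its mirror
    image as a companion. *)
Lemma multi_global_even b h : bh < b -> 0 <= h ->
  more_than_one (global_maximizer b h p) <-> h = Num.max 0 (@coex 0 b).
Proof.
move=> hb h0; have sP : left_end 0 by left.
have [a [c S]] := shape_ex p3 hb; have [/andP[a0 am] /andP[mc c1] KI _ _] := S.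
have [m0 m1] := andP (@apex_itv R p p3).
have MI := shape_mid_even p3 S pe; have RI := shape_right S.
split=> [[x [y [xy xM yM]]]|hE].
  have [h0'|h0'] := ltP 0 h.
    have pos z : global_maximizer b h p z -> 0 < z < a \/ c < z < 1.
      move=> zM; have zL := global_local_max zM.
      have [z1 zh] := local_max_crit p3 zL.
      have z0 : z != 0.
        by apply/eqP => z0; move: zh; rewrite z0 crit_field0//; lra.
      have z0' : 0 < z.
        rewrite ltNge; apply/negP => z0'.
        have := zM.2 (- z); rewrite in_itv/= HN_sub => /(_ ltac:(lra)).
        have zn : z < 0 by lra.
        by nra.
      have := local_max_shape p3 S zL; have [za|az] := ltP z a.
        by left; lra.
      by have [zc|cz] := leP z c => // _; right; lra.
    wlog {}xy : x y xM yM {xy} / x < y.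
      move=> wl; have [xy'|yx'|xyE] := ltgtP x y; first exact: (wl x y).
      - exact: (wl y x).
      - by move: xy; rewrite xyE eqxx.
    have [_ xh] := local_max_crit p3 (global_local_max xM).
    have [_ yh] := local_max_crit p3 (global_local_max yM).
    have xyE : K b x = K b y by rewrite xh yh.
    have [xa yc] : 0 < x < a /\ c < y < 1.
      have [xp|xp] := pos x xM; have [yp|yp] := pos y yM => //.
      + by move: xy; rewrite (incr_on_inj MI _ _ xyE) ?ltxx//; lra.
      + by exfalso; lra.
      + by move: xy; rewrite (incr_on_inj RI _ _ xyE) ?ltxx//; lra.
    have <- : h = @coex 0 b.
      apply: (gap_eq0 sP hb); apply: (@gap0_of_maximizers _ sP b h x y); try lra.
      - by move=> z z1; apply: xM.2; rewrite in_itv/=; lra.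
      - by move=> z z1; apply: yM.2; rewrite in_itv/=; lra.
    by rewrite max_r// ltW.
  have {}h0 : h = 0 by apply/eqP; rewrite eq_le h0'.
  subst h.
  have nonzero z : z != 0 -> global_maximizer b 0 p z -> @coex 0 b <= 0.
    wlog z0 : z / 0 < z.
      move=> wl z0 zM; have [z0'|z0'|zE] := ltgtP z 0.
      - apply: (wl (- z)); rewrite ?oppr_gt0 ?oppr_eq0//.
        by have := global_maxN pe zM; rewrite oppr0.
      - exact: (wl z).
      - by move: z0; rewrite zE eqxx.
    move=> _ zM; have zL := global_local_max zM.
    have [z1 zh] := local_max_crit p3 zL.
    have cz : c < z.
      have := local_max_shape p3 S zL; have [za|az] := leP a z.
        by have [zc|] := leP z c.
      have := KI 0 z (lexx _) z0 (ltW az).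
      by rewrite zh crit_field0// ltxx.
    rewrite leNgt -gap_lt0// subr_lt0 -leNgt.
    apply: (le_trans (y := H b 0 z)); last by apply: le_peak; lra.
    have [|u [um -> _]] := @peak_attained 0 m b 0; first exact: ltW.
    by apply: zM.2; rewrite in_itv/=; lra.
  rewrite max_l//; have [x0|x0] := eqVneq x 0; last exact: nonzero xM.
  by apply: nonzero yM; rewrite -x0 eq_sym.
have [c0|c0] := leP 0 (@coex 0 b).
  have {}hE : h = @coex 0 b by rewrite hE max_r.
  have [x [y [xm ym xyE xM]]] := gap0_maximizers sP hb (gap_coex sP hb).
  rewrite -hE in xyE xM.
  exists x, y; split; first by rewrite lt_eqF//; lra.
  - by apply: even_global => //; lra.
  - by apply: even_global => //; [lra|move=> z z1; rewrite -xyE xM].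
have {}hE : h = 0 by rewrite hE max_l// ltW.
subst h; have := gap_gt0 sP 0 hb; rewrite c0 subr_gt0 => lr.
have [|x [xm xE _]] := @peak_attained m 1 b 0; first by lra.
have xM : global_maximizer b 0 p x.
  apply: even_global => //; first by lra.
  move=> z z1; rewrite -xE; have [zm|mz] := leP z m.
    by apply: le_trans (ltW lr); apply: le_peak; lra.
  by apply: le_peak; lra.
exists x, (- x); split=> //; first by rewrite gt_eqF//; lra.
by have := global_maxN pe xM; rewrite oppr0.
Qed.

End EvenGlobal.

End Coexistence.

(** * The remaining thresholds *)

Section Thresholds.
#[local] Set Implicit Arguments.
#[local] Unset Strict Implicit.
Context {R : realType} {p : nat} (p3 : (3 <= p)%N).
Implicit Types (b h x y z : R).

Let p1 : (1 < p)%N. Proof. exact: ltn_trans p3. Qed.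

Local Notation m := (@apex R p).
Local Notation K b := (crit_field b p).
Local Notation bh := (@beta_hat R p).
Local Notation U := (@upper R p).
Local Notation L := (@lower R p).

Lemma no_multi_local_sub b h : 0 < b -> more_than_one (local_maximizer b h p) ->
  bh < b.
Proof.
move=> b0 M; rewrite ltNge; apply/negP => hb.
by apply: (incr_on_unique_max p3 _ M); apply: incr_on_subcritical; rewrite // b0.
Qed.

Lemma multi_global_local b h : more_than_one (global_maximizer b h p) ->
  more_than_one (local_maximizer b h p).
Proof.
by move=> [x [y [xy xM yM]]]; exists x, y; split=> //; exact: global_local_max.
Qed.

Lemma lower_root : exists2 b, bh < b & L b = 0.
Proof.
have h0 : 0 < L bh by rewrite lower_hat// h_hat_gt0.
have [B [hB LB]] : exists B, bh < B /\ L B <= 0.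
  apply: (@filter_ex _ (+oo : set_system R)).
  near=> B; split; first by near: B; apply: nbhs_pinfty_gt; exact: num_real.
  by near: B; exact: ((cvgrNyPle _).1 (@lower_cvgNy R p p3) 0).
have [||b] := @IVT R L bh B 0 (ltW hB).
- exact/continuous_subspaceT/continuous_lower.
- by rewrite ge_min le_max (ltW h0) LB orbT.
rewrite in_itv/= => /andP[hb bB] b0; exists b => //.
by rewrite lt_neqAle hb andbT; apply/eqP => bE; move: h0; rewrite bE b0 ltxx.
Unshelve. all: by end_near. Qed.

(** [H b 0 p] is nonincreasing on [0, 1[ exactly when its critical field is
    nonnegative there, that is, when [lower b >= 0]. *)
Lemma beta_primeE b : bh < b -> L b = 0 -> beta_prime p = b.
Proof.
have [m0 m1] := andP (@apex_itv R p p3).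
move=> hb b0; have bh0 := beta_hat_gt0 (R := R) p3.
have dE b' x : x \in `[0, 1[ -> derive1 (H b' 0 p) x = - K b' x.
  rewrite in_itv/= => x01; have d := @is_derive_H R b' 0 p x ltac:(lra).
  by rewrite derive1E derive_val sub0r.
have imE b' : [set derive1 (H b' 0 p) x | x in `[0, 1[] =
    [set - K b' x | x in `[0, 1[].
  by apply: eq_imagel => x /dE.
have supE b' : (forall x, 0 <= x < 1 -> 0 <= K b' x) <->
    sup [set - K b' x | x in `[0, 1[] = 0.
  split=> [K0|supE x x01].
    rewrite (@sup_image_max R (fun x => - K b' x) _ 0) ?crit_field0 ?oppr0//=.
      by rewrite in_itv/= lexx ltr01.
    by move=> y; rewrite in_itv/= oppr_le0; exact: K0.
  rewrite -oppr_le0 -[leRHS]supE; apply: ub_le_sup; last by exists x.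
  exists `|b' * p%:R| => v [y /=]; rewrite in_itv/= => y01 <-{v}.
  have : b' * p%:R * y ^+ p.-1 <= `|b' * p%:R|.
    by rewrite (le_trans (ler_norm _))// normrM ler_piMr// pow_abs_le1//; lra.
  have := @artanh_ge0 R y y01; rewrite /crit_field; lra.
rewrite /beta_prime -[RHS](@sup_image_max R id [set b' | 0 < b' <= b] b).
- congr sup; apply/seteqP; split=> [b' [b'0]|_ [b' /= /andP[b'0 b'b] <-]].
    rewrite imE => /supE K0; exists b' => //=; rewrite b'0 leNgt.
    apply/negP => bb'; have [a [c S]] := shape_ex p3 (lt_trans hb bb').
    have [_ /andP[mc c1] _ _ _] := S.
    have := lower_decr p3 hb bb'; rewrite b0 (lowerE S) ltNge K0//.
    by rewrite c1 andbT; lra.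
  split=> //; rewrite imE; apply/supE => x x01.
  have [a [c S]] := shape_ex p3 hb; have [/andP[a0 am] /andP[mc c1] KI Kd _] := S.
  have Kb : 0 <= K b x.
    have [xm|mx] := leP x m; last by rewrite -b0; apply: ge_lower => //; lra.
    have [ax|xa] := ltP a x.
      by rewrite -b0 (lowerE S); apply/ltW/Kd; lra.
    have [->|x0] := eqVneq x 0; first by rewrite crit_field0.
    by rewrite -(crit_field0 p3 b); apply/ltW/KI; lra.
  have [->|bb'] := eqVneq b' b; first exact: Kb.
  have [->|x0] := eqVneq x 0; first by rewrite crit_field0.
  apply: le_trans Kb _; apply/ltW/crit_field_decr_b => //; lra.
- by rewrite /= lexx andbT; lra.
- by move=> b' /= /andP[].
Qed.

(** For even [p] the upper boundary is the larger of the level where the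
    middle maximizer dies and the level where the negative one dies. *)
Definition upper_even b : R := Num.max (U b) (- L b).

Lemma continuous_upper_even : continuous upper_even.
Proof.
move=> b; apply: continuous_max; first exact: continuous_upper.
by apply: cvgN; exact: continuous_lower.
Qed.

Lemma upper_even_cvgy : upper_even b @[b --> +oo] --> +oo.
Proof.
apply/cvgryPge => M; near=> b; rewrite le_max lerNr; apply/orP; right.
by near: b; exact: ((cvgrNyPle _).1 (@lower_cvgNy R p p3) (- M)).
Unshelve. all: by end_near. Qed.

Lemma upper_even_switch : exists2 b0, bh < b0 & U b0 + L b0 = 0.
Proof.
have h0 := @h_hat_gt0 R p p3.
have [B [hB UB]] : exists B, bh < B /\ U B + L B <= 0.
  apply: (@filter_ex _ (+oo : set_system R)).
  near=> B; split; first by near: B; apply: nbhs_pinfty_gt; exact: num_real.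
  have : L B <= -1.
    by near: B; exact: ((cvgrNyPle _).1 (@lower_cvgNy R p p3) (-1)).
  have : U B <= 1.
    apply: le_trans (ler_norm _) _; near: B.
    exact: ((cvgr0Pnorm_le _).1 (@upper_cvg0 R p p3) 1 ltr01).
  by lra.
have [||b] := @IVT R (fun b => U b + L b) bh B 0 (ltW hB).
- apply: continuous_subspaceT => b.
  by apply: cvgD; [exact: continuous_upper|exact: continuous_lower].
- by rewrite ge_min le_max upper_hat// lower_hat// UB orbT/=; lra.
rewrite in_itv/= => /andP[hb bB] b0; exists b => //.
rewrite lt_neqAle hb andbT; apply/eqP => bE; move: b0.
by rewrite -bE upper_hat// lower_hat//; lra.
Unshelve. all: by end_near. Qed.

Lemma upper_even_left b0 b : U b0 + L b0 = 0 -> bh < b -> b < b0 ->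
  upper_even b = U b.
Proof.
move=> b00 hb bb0; rewrite /upper_even max_l//.
by have := upper_decr p3 hb bb0; have := lower_decr p3 hb bb0; lra.
Qed.

Lemma upper_even_right b0 b : bh < b0 -> U b0 + L b0 = 0 -> b0 < b ->
  upper_even b = - L b.
Proof.
move=> hb b00 b0b; rewrite /upper_even max_r//.
by have := upper_decr p3 hb b0b; have := lower_decr p3 hb b0b; lra.
Qed.

Lemma multi_globalN b h : ~~ odd p -> more_than_one (global_maximizer b h p) ->
  more_than_one (global_maximizer b (- h) p).
Proof.
move=> pe [x [y [xy xM yM]]]; exists (- x), (- y).
by split; rewrite ?eqr_opp//; exact: global_maxN.
Qed.

Lemma multi_local_even_above b h : ~~ odd p -> bh < b -> L b < 0 ->
  more_than_one (local_maximizer b h p) <-> - upper_even b < h < upper_even b.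
Proof.
move=> pe hb; have [a [c S]] := shape_ex p3 hb.
have u0 := upper_gt0 p3 hb; move: u0.
rewrite /upper_even (upperE S) (lowerE S) => u0 l0.
apply: (iff_trans (multi_local_even p3 S pe h)).
rewrite !(lt_min, gt_max, lt_max) [- Num.max _ _ < _]ltrNl lt_max.
split=> [[/and3P[h1 h2 h3]|/andP[/andP[h1 h2] h3]|/andP[h1 h2]]|].
- by apply/andP; split; apply/orP; [left|left]; lra.
- by apply/andP; split; apply/orP; [left|left]; lra.
- by apply/andP; split; apply/orP; [right|right]; lra.
move=> /andP[h1 h2].
have [hu|hu] := ltP `|h| (K b a).
  move: hu; rewrite ltr_norml => hu; have [h0|h0] := ltP h 0.
    by constructor 1; apply/and3P; split; lra.
  by constructor 2; apply/andP; split; [apply/andP; split|]; lra.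
constructor 3; move: hu; rewrite ler_normr => /orP[hu|hu].
  by case/orP: h2 => ?; lra.
by case/orP: h1 => ?; lra.
Qed.

Lemma multi_local_even_below b h : ~~ odd p -> bh < b -> 0 <= L b ->
  more_than_one (local_maximizer b h p) <->
  exists h', L b < h' < upper_even b /\ (h = h' \/ h = - h').
Proof.
move=> pe hb l0; have u0 := upper_gt0 p3 hb.
have -> : upper_even b = U b by rewrite /upper_even max_l//; lra.
move: u0 l0; have [a [c S]] := shape_ex p3 hb.
rewrite (upperE S) (lowerE S) => u0 l0.
apply: (iff_trans (multi_local_even p3 S pe h)); rewrite !(lt_min, gt_max).
split=> [[/and3P[h1 h2 h3]|/andP[/andP[h1 h2] h3]|/andP[h1 h2]]|].
- by exists (- h); rewrite opprK; split; [lra|right].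
- by exists h; split; [lra|left].
- by exfalso; lra.
move=> [h' [h'lu [->|->]]].
- by constructor 2; apply/andP; split; [apply/andP; split|]; lra.
- by constructor 1; apply/and3P; split; lra.
Qed.

(** The two boundaries meet at [(beta_hat p, h_hat p)], where the falling
    branch of the field shrinks to the point [apex]. *)
Lemma cvg_corner (C : R -> R) : (forall b, bh < b -> L b < C b < U b) ->
  C b @[b --> bh^'+] --> (h_hat p : R).
Proof.
move=> LCU; apply: (@squeeze_cvgr _ _ _ _ L U).
- near=> b; have hb : bh < b by near: b; exact: nbhs_right_gt.
  by have /andP[/ltW -> /ltW ->] := LCU b hb.
- rewrite -(lower_hat (R := R) p3).
  by apply: cvg_at_right_filter; exact: continuous_lower.
- rewrite -(upper_hat (R := R) p3).
  by apply: cvg_at_right_filter; exact: continuous_upper.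
Unshelve. all: by end_near. Qed.

End Thresholds.

Theorem lemmaA1 (R : realType) (p : nat) (hp : (3 <= p)%N) :
  let bh : R := beta_hat p in
  let hh : R := h_hat p in
  let bt : R := beta_tilde p in
  let bp : R := beta_prime p in
  (odd p ->
    bh < bt /\
    exists U C L : R -> R,
      [/\ strictly_decreasing_on `]bh, +oo[ U,
          strictly_decreasing_on `]bh, +oo[ C &
          strictly_decreasing_on `]bh, +oo[ L] /\
      [/\ {within `]bh, +oo[, continuous U},
          {within `]bh, +oo[, continuous C} &
          {within `]bh, +oo[, continuous L}] /\
      (* (a) *)
      [/\ C bt = 0,
          C b @[b --> +oo] --> -oo &
          multi_global p = [set z | bh < z.1 /\ z.2 = C z.1]] /\
      (* (b) *)
      (forall b, bh < b -> L b < C b < U b) /\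
      (* (c) *)
      multi_local p = [set z | bh < z.1 /\ L z.1 < z.2 < U z.1] /\
      (* (d) *)
      ((forall b, bh < b -> 0 < U b) /\ U b @[b --> +oo] --> (0 : R)) /\
      (* (e) *)
      [/\ U b @[b --> bh^'+] --> hh,
          C b @[b --> bh^'+] --> hh &
          L b @[b --> bh^'+] --> hh])
  /\
  (~~ odd p ->
    bh < bp < bt /\
    exists U C L : R -> R,
      [/\ {within `]bh, +oo[, continuous U},
          {within `]bh, +oo[, continuous C},
          {within `]bh, bp], continuous L} &
          strictly_decreasing_on `]bh, bp] L] /\
      (* (a) *)
      [/\ strictly_decreasing_on `]bh, bt[ C,
          forall b, bt <= b -> C b = 0 &
          multi_global p =
            [set z | bh < z.1 /\ (z.2 = C z.1 \/ z.2 = - C z.1)]] /\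
      (* (b) *)
      [/\ forall b, bh < b < bp -> 0 < L b < U b,
          L bp = 0 &
          forall b, bh < b ->
            (bounded_region bh bp L U)° (b, C b) /\
            (bounded_region bh bp L U)° (b, - C b)] /\
      (* (c) *)
      multi_local p =
        [set z | bp < z.1 /\ - U z.1 < z.2 < U z.1] `|`
        [set z | bh < z.1 <= bp /\
                 exists h, L z.1 < h < U z.1 /\ (z.2 = h \/ z.2 = - h)] /\
      (* (d) *)
      ((exists b0, [/\ bp < b0,
                       strictly_decreasing_on `]bh, b0[ U &
                       strictly_increasing_on `]b0, +oo[ U]) /\
       U b @[b --> +oo] --> +oo) /\
      (* (e) *)
      [/\ U b @[b --> bh^'+] --> hh,
          C b @[b --> bh^'+] --> hh &
          L b @[b --> bh^'+] --> hh]).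
Proof.
move=> bh hh bt bp.
have bh0 : 0 < bh := beta_hat_gt0 hp.
have Lc := continuous_lower (R := R) hp; have Uc := continuous_upper (R := R) hp.
have hatL : @lower R p b @[b --> bh^'+] --> hh.
  by rewrite /hh -(lower_hat (R := R) hp); apply: cvg_at_right_filter; exact: Lc.
have hatU : @upper R p b @[b --> bh^'+] --> hh.
  by rewrite /hh -(upper_hat (R := R) hp); apply: cvg_at_right_filter; exact: Uc.
have within_of f (A : interval R) : (forall b, b \in A -> {for b, continuous f}) ->
    {within [set` A], continuous (f : R -> R)}.
  by move=> fA; apply: continuous_in_subspaceT => b; rewrite inE; exact: fA.
split=> [po|pe].
  have sP : @left_end R p (-1) by right.
  have [b2 hb2 C2] := coex_root hp sP.
  have btE : bt = b2 := beta_tildeE hp sP hb2 C2.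
  split; first by rewrite btE.
  exists (@upper R p), (@coex R p (-1)), (@lower R p).
  split; last split; last split; last split; last split; last split.
  - split=> b b'; rewrite !in_itv/= !andbT => hb hb' bb'.
    + exact: upper_decr.
    + exact: coex_decr.
    + exact: lower_decr.
  - split; apply: within_of => b; rewrite in_itv/= andbT => hb.
    + exact: Uc.
    + exact: continuous_coex.
    + exact: Lc.
  - split; [by rewrite btE|exact: coex_cvgNy|].
    apply/seteqP; split=> [[b h] [/= b0 M]|[b h] [/= hb hE]].
      have hb := no_multi_local_sub hp b0 (multi_global_local M).
      by split=> //; apply/(multi_global_odd hp _ po hb).
    by split; [exact: lt_trans hb|apply/(multi_global_odd hp _ po hb)].
  - by move=> b hb; exact: coex_itv.
  - apply/seteqP; split=> [[b h] [/= b0 M]|[b h] [/= hb hE]].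
      have hb := no_multi_local_sub hp b0 M; split=> //.
      have [a [c S]] := shape_ex hp hb; rewrite (upperE S) (lowerE S).
      exact/(multi_local_odd hp S po b0).
    have b0 : 0 < b := lt_trans bh0 hb.
    split=> //; have [a [c S]] := shape_ex hp hb.
    by apply/(multi_local_odd hp S po b0); rewrite -(upperE S) -(lowerE S).
  - by split; [move=> b; exact: upper_gt0|exact: upper_cvg0].
  - by split=> //; apply: cvg_corner => // b; exact: coex_itv.
have sP : @left_end R p 0 by left.
have [b1 hb1 L1] := lower_root (R := R) hp.
have [b2 hb2 C2] := coex_root hp sP.
have [b3 hb3 UL3] := upper_even_switch (R := R) hp.
have bpE : bp = b1 := beta_primeE hp hb1 L1.
have btE : bt = b2 := beta_tildeE hp sP hb2 C2.
have bp_bt : bp < bt.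
  rewrite bpE btE ltNge; apply/negP => b21.
  have := coex_itv hp sP hb2; rewrite C2 => /andP[L2 _].
  move: b21; rewrite le_eqVlt => /predU1P[E|b21].
    by move: L2; rewrite E L1 ltxx.
  by have := lower_decr hp hb2 b21; rewrite L1; lra.
have hbp : bh < bp by rewrite bpE.
have L_lt0 b : bp < b -> @lower R p b < 0.
  by rewrite bpE -L1 => /(lower_decr hp hb1).
have L_ge0 b : bh < b -> b <= bp -> 0 <= @lower R p b.
  rewrite bpE le_eqVlt => hb /predU1P[->|bb1]; first by rewrite L1.
  by rewrite -L1; apply/ltW/lower_decr.
(* Once [coex] is negative, the two mirror images win at [h = 0]. *)
pose U : R -> R := @upper_even R p; pose C b : R := Num.max 0 (@coex R p 0 b).
have Ucont : continuous U := continuous_upper_even hp.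
have C_ge0 b : 0 <= C b by rewrite le_max lexx.
have LCU' b : bh < b -> @lower R p b < C b < @upper R p b.
  move=> hb; have /andP[lc cu] := coex_itv hp sP hb.
  by rewrite lt_max lc orbT/= /C gt_max cu (upper_gt0 hp hb).
have LCU b : bh < b -> @lower R p b < C b < U b.
  by move=> /LCU'/andP[-> cu]; rewrite lt_max cu.
have Ccont b : bh < b -> {for b, continuous C}.
  move=> hb; apply: continuous_max; first exact: cvg_cst.
  exact: continuous_coex.
have Cpos b : bh < b -> b < bt -> C b = @coex R p 0 b.
  move=> hb bbt; apply: max_r; rewrite -[leLHS]C2 ltW//.
  by apply: coex_decr => //; rewrite -btE.
have C0 b : bt <= b -> C b = 0.
  rewrite btE le_eqVlt => /predU1P[<-|bb]; first by rewrite /C C2 maxxx.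
  by apply: max_l; rewrite -[leRHS]C2 ltW// coex_decr.
split; first by rewrite hbp.
exists U, C, (@lower R p); split; last split; last split; last split; last split.
- split; [exact: continuous_subspaceT| | |].
  + by apply: within_of => b; rewrite in_itv/= andbT; exact: Ccont.
  + exact: continuous_subspaceT.
  + move=> b b'; rewrite !in_itv/= => /andP[hb _] /andP[hb' _] bb'.
    exact: lower_decr.
- split=> //.
    move=> b b'; rewrite !in_itv/= => /andP[hb bb] /andP[hb' bb'] b'b.
    by rewrite !Cpos//; exact: coex_decr.
  apply/seteqP; split=> [[b h] [/= b0 M]|[b h] [/= hb hE]].
    have hb := no_multi_local_sub hp b0 (multi_global_local M); split=> //.
    have [h0|h0] := leP 0 h.
      by left; apply/(multi_global_even hp pe hb h0).
    right; apply/eqP; rewrite -eqr_oppLR; apply/eqP.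
    apply/(multi_global_even hp pe hb); first by rewrite oppr_ge0 ltW.
    exact: multi_globalN.
  split; first exact: lt_trans hb.
  have M : more_than_one (global_maximizer b (C b) p).
    by apply/(multi_global_even hp pe hb (C_ge0 b)).
  by case: hE => ->//; exact: multi_globalN.
- split; last first.
  + move=> b hb; have /andP[lc cu] := LCU b hb.
    have near_region z0 : z0.1 = b -> `|z0.2| = C b ->
        (bounded_region bh bp (@lower R p) U)° z0.
      move=> z1 z2.
      have near1 : \forall z \near z0, bh < z.1.
        apply: (@cvg_fst _ _ _ _ _ [set b | bh < b]).
        by apply: lt_nbhsr; rewrite z1.
      have gap_cvg (f : R -> R) (e : R) : continuous f ->
          {for z0, continuous (fun z : R * R => e * (f z.1 - `|z.2|))}.
        move=> fc; apply: cvgM; first exact: cvg_cst.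
        apply: cvgB.
          apply: (@continuous_comp _ _ _ (fun z : R * R => z.1) f z0).
            exact: cvg_fst.
          exact: fc.
        apply: (@continuous_comp _ _ _ (fun z : R * R => z.2)
          (fun x : R => `|x|) z0); first exact: cvg_snd.
        exact: norm_continuous.
      have near2 : \forall z \near z0, 0 < 1 * (U z.1 - `|z.2|).
        apply: (gap_cvg U 1 Ucont [set e | 0 < e]).
        by apply: lt_nbhsr; rewrite z1 z2; lra.
      have near3 : \forall z \near z0, 0 < -1 * (@lower R p z.1 - `|z.2|).
        apply: (gap_cvg (@lower R p) (-1) Lc [set e | 0 < e]).
        by apply: lt_nbhsr; rewrite z1 z2; lra.
      near=> z; split.
      - by near: z.
      - by apply: ltW; rewrite -subr_gt0 -[ltRHS]mul1r; near: z.
      - by move=> _; apply: ltW; rewrite -subr_gt0 -opprB -mulN1r; near: z.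
    by split; apply: near_region; rewrite //= ?normrN ger0_norm.
  + by rewrite bpE.
  + move=> b /andP[hb bb]; have /andP[lc cu] := LCU b hb.
    rewrite (lt_trans lc cu) andbT -L1 -bpE lower_decr//.
- apply/seteqP; split=> [[b h] [/= b0 M]|[b h] [[/= hb hE]|[/= /andP[hb bb] hE]]].
  + have hb := no_multi_local_sub hp b0 M; have [bb|bb] := leP b bp.
      right; split; first by rewrite hb.
      exact/(multi_local_even_below hp _ pe hb (L_ge0 _ hb bb)).
    by left; split=> //; apply/(multi_local_even_above hp _ pe hb (L_lt0 _ bb)).
  + have hb' := lt_trans hbp hb.
    split; first exact: lt_trans hb'.
    exact/(multi_local_even_above hp _ pe hb' (L_lt0 _ hb)).
  + split; first exact: lt_trans hb.
    exact/(multi_local_even_below hp _ pe hb (L_ge0 _ hb bb)).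
- split; last exact: upper_even_cvgy.
  have b13 : bp < b3.
    rewrite ltNge; apply/negP => b31; have := L_ge0 _ hb3 b31.
    by have := upper_gt0 hp hb3; lra.
  exists b3; split=> // b b'; rewrite !in_itv/=.
    move=> /andP[hb bb] /andP[hb' bb'] b'b.
    by rewrite /U !(upper_even_left hp UL3)//; exact: upper_decr.
  rewrite !andbT => hb hb' bb'.
  rewrite /U !(upper_even_right hp hb3 UL3)// ltrN2.
  by apply: lower_decr => //; exact: lt_trans hb.
- split=> //; last by apply: cvg_corner.
  have -> : hh = U bh.
    rewrite /U /upper_even upper_hat// lower_hat// max_l//.
    by have := h_hat_gt0 (R := R) hp; lra.
  by apply: cvg_at_right_filter; exact: Ucont.
Unshelve. all: by end_near. Qed.
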